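(* Let $q\in\mathbb{C}\setminus\{0\}$ and let $\Lambda\ge2$ be an integer. Let $S_1\subseteq S_2\subseteq\cdots\subseteq S_{\Lambda-1}\subseteq\mathbb{C}$ satisfy: (1) for all $k,\ell\in\{1,\dots,\Lambda-1\}$ and all $a\in S_k$, $b\in S_\ell$: $q+a+b\neq0$ and $a\bowtie_q b\in S_{\min(k,\ell)}$; (2) for all $k,\ell\ge1$ with $k+\ell\le\Lambda-1$ and all $a\in S_k$, $b\in S_\ell$: $a\| b\in S_{k+\ell}$. Let $(G,s,t)$ be any 2-terminal series-parallel graph with a maximal decomposition tree in which every proper constituent $(H,a,b)$ has $\lambda_H(a,b)\le\Lambda-1$, and give $G$ complex edge weights $v_e\in S_1$. Then for every node $(H,a,b)$ of the tree with $\lambda_H(a,b)\le\Lambda-1$, we have $A_{H,a,b}(q,\mathbf v)\neq0$ and $v_{\rm eff}(H,a,b)=B_{H,a,b}(q,\mathbf v)/A_{H,a,b}(q,\mathbf v)\in S_{\lambda_H(a,b)}$. If moreover (3) $-q\notin S_{\Lambda-1}$ and (4) $-q\notin\{a\|b: a\in S_k, b\in S_\ell\}$ for all $k,\ell\ge1$ with $k+\ell=\Lambda$, then for every loopless series-parallel graph $G$ with maxmaxflow at most $\Lambda$ and every choice of edge weights with $v_e\in S_1$ for all edges $e$, we have $Z_G(q,\mathbf v)\neq0$.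
   Context: For $a,b\in\mathbb C$: $a\|b=(1+a)(1+b)-1$ (parallel connection), and $a\bowtie_q b=ab/(q+a+b)$ when $q+a+b\ne0$ (series connection). Multivariate Tutte polynomial: $Z_G(q,\mathbf v)=\sum_{A\subseteq E}q^{k(A)}\prod_{e\in A}v_e$, $k(A)$ = number of components of $(V,A)$. $\lambda_G(x,y)$ = maximum number of edge-disjoint $x$–$y$ paths; maxmaxflow $\Lambda(G)=\max_{x\neq y}\lambda_G(x,y)$ (0 if fewer than two vertices). A loopless graph is series-parallel if obtainable from a forest by finitely many operations replacing an edge by two edges in series or two parallel edges. A 2-terminal graph $(G,s,t)$ has distinct terminals $s,t$; parallel composition identifies $s_2$ with $s_1$ and $t_2$ with $t_1$ (terminals $s_1,t_1$); series composition identifies $t_1$ with $s_2$ (terminals $s_1,t_2$). A 2-terminal graph is 2-terminal series-parallel if it is $K_2$ or the series or parallel composition of two smaller 2-terminal series-parallel graphs. Partial polynomials: $A_{G,s,t}=q^{-2}\sum q^{k(A)}\prod_{e\in A}v_e$ over $A$ not connecting $s$ to $t$, $B_{G,s,t}=q^{-1}\sum q^{k(A)}\prod_{e\in A}v_e$ over $A$ connecting $s$ to $t$. A decomposition tree of $(G,s,t)$ (with $G$ connected, loopless) is a rooted tree with every node having 0 or 2 children, each node a connected 2-terminal graph whose underlying graph is a subgraph of $G$, root $(G,s,t)$, and each non-leaf node equal to the series composition ($s$-node, children ordered) or parallel composition ($p$-node) of its two children; nodes are called constituents, proper if not the root. A 2-terminal graph is prime if it is not the series or parallel composition of two strictly smaller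 2-terminal graphs; a decomposition tree is maximal if all its leaves are prime (for 2-terminal series-parallel graphs, the leaves of a maximal decomposition tree are then single edges). *)

(* Defs.v *)
(* Complex numbers are modelled by an arbitrary
   numClosedFieldType F (e.g. algC). *)
From HB Require Import structures.
From mathcomp Require Import all_boot all_order all_algebra.
Set Implicit Arguments. Unset Strict Implicit. Unset Printing Implicit Defensive.
Import Order.TTheory GRing.Theory Num.Theory.

(* An edge e joins gs e and gt e (undirected; loops/multi-edges allowed). *)
Record graph := Graph {
  gV : finType;
  gE : finType;
  gs : gE -> gV;
  gt : gE -> gV }.

Definition joins (G : graph) (e : gE G) (x y : gV G) : bool :=
  ((gs e == x) && (gt e == y)) || ((gs e == y) && (gt e == x)).

Definition adj (G : graph) (A : {set gE G}) : rel (gV G) :=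
  fun x y => [exists e in A, joins e x y].

Definition kcomp (G : graph) (VS : {set gV G}) (A : {set gE G}) : nat :=
  #|[set [set y in VS | connect (adj A) x y] | x in VS]|.

Definition loopless (G : graph) : Prop := forall e : gE G, gs e != gt e.

Definition forest (G : graph) : Prop :=
  loopless G /\
  forall e : gE G, ~~ connect (adj (setT :\ e)) (gs e) (gt e).

(* G is obtained from G' by replacing the edge e' = {u,w'} by two edges
   e1 = {u,w}, e2 = {w,w'} in series (w a new vertex); f, g identify
   the remaining vertices/edges. *)
Definition ser_replace (G' G : graph) : Prop :=
  exists (e' : gE G') (w : gV G) (e2 : gE G)
         (f : gV G' -> gV G) (g : gE G' -> gE G),
    [/\ injective f, (forall x, f x != w) & (forall y, y != w -> exists x, f x = y)] /\
    [/\ injective g, (forall e, g e != e2) & (forall e, e != e2 -> exists e0, g e0 = e)] /\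
    [/\ (forall e, e != e' -> joins (g e) (f (gs e)) (f (gt e))),
        joins (g e') (f (gs e')) w & joins e2 w (f (gt e'))].

(* G is obtained from G' by replacing the edge e' by two parallel edges
   (g e' and e2). *)
Definition par_replace (G' G : graph) : Prop :=
  exists (e' : gE G') (e2 : gE G)
         (f : gV G' -> gV G) (g : gE G' -> gE G),
    [/\ bijective f, injective g, (forall e, g e != e2) &
        (forall e, e != e2 -> exists e0, g e0 = e)] /\
    (forall e, joins (g e) (f (gs e)) (f (gt e))) /\
    joins e2 (f (gs e')) (f (gt e')).

Inductive sp_graph : graph -> Prop :=
| sp_forest G : forest G -> sp_graph G
| sp_ser G' G : sp_graph G' -> ser_replace G' G -> sp_graph G
| sp_par G' G : sp_graph G' -> par_replace G' G -> sp_graph G.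

Record tgraph (G : graph) := TG {
  tV : {set gV G};
  tE : {set gE G};
  ta : gV G;
  tb : gV G }.

Definition full (G : graph) (s t : gV G) : tgraph G := @TG G setT setT s t.

Definition wf_tg (G : graph) (T : tgraph G) : Prop :=
  [/\ ta T != tb T, ta T \in tV T, tb T \in tV T &
      forall e, e \in tE T -> (gs e \in tV T) && (gt e \in tV T)].

Definition connected_tg (G : graph) (T : tgraph G) : Prop :=
  forall x y, x \in tV T -> y \in tV T -> connect (adj (tE T)) x y.

Definition par_comp (G : graph) (T T1 T2 : tgraph G) : Prop :=
  [/\ wf_tg T1, wf_tg T2,
      ta T1 = ta T /\ ta T2 = ta T & tb T1 = tb T /\ tb T2 = tb T] /\
  [/\ tV T = tV T1 :|: tV T2, tV T1 :&: tV T2 = [set ta T; tb T],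
      tE T = tE T1 :|: tE T2 & tE T1 :&: tE T2 = set0].

Definition ser_comp (G : graph) (T T1 T2 : tgraph G) : Prop :=
  [/\ wf_tg T1, wf_tg T2,
      ta T = ta T1 /\ tb T = tb T2 & tb T1 = ta T2] /\
  [/\ tV T = tV T1 :|: tV T2, tV T1 :&: tV T2 = [set tb T1],
      tE T = tE T1 :|: tE T2 & tE T1 :&: tE T2 = set0].

Inductive tsp (G : graph) : tgraph G -> Prop :=
| tsp_K2 T e : ta T != tb T -> tV T = [set ta T; tb T] -> tE T = [set e] ->
    joins e (ta T) (tb T) -> tsp T
| tsp_ser T T1 T2 : tsp T1 -> tsp T2 -> ser_comp T T1 T2 -> tsp T
| tsp_par T T1 T2 : tsp T1 -> tsp T2 -> par_comp T T1 T2 -> tsp T.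

Definition tsize (G : graph) (T : tgraph G) : nat := #|tV T| + #|tE T|.

Definition prime_tg (G : graph) (T : tgraph G) : Prop :=
  ~ exists T1 T2 : tgraph G,
      [/\ (tsize T1 < tsize T)%N, (tsize T2 < tsize T)%N &
          ser_comp T T1 T2 \/ par_comp T T1 T2].

Inductive dtree (G : graph) :=
| Leaf of tgraph G
| SNode of tgraph G & dtree G & dtree G
| PNode of tgraph G & dtree G & dtree G.

Definition lab (G : graph) (tr : dtree G) : tgraph G :=
  match tr with Leaf T => T | SNode T _ _ => T | PNode T _ _ => T end.

Fixpoint valid_tree (G : graph) (tr : dtree G) : Prop :=
  match tr with
  | Leaf T => wf_tg T /\ connected_tg T
  | SNode T l r => [/\ wf_tg T, connected_tg T, ser_comp T (lab l) (lab r),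
                      valid_tree l & valid_tree r]
  | PNode T l r => [/\ wf_tg T, connected_tg T, par_comp T (lab l) (lab r),
                      valid_tree l & valid_tree r]
  end.

Definition decomp_tree (G : graph) (tr : dtree G) (T : tgraph G) : Prop :=
  loopless G /\ valid_tree tr /\ lab tr = T.

Fixpoint all_nodes (G : graph) (P : tgraph G -> Prop) (tr : dtree G) : Prop :=
  match tr with
  | Leaf T => P T
  | SNode T l r => [/\ P T, all_nodes P l & all_nodes P r]
  | PNode T l r => [/\ P T, all_nodes P l & all_nodes P r]
  end.

Fixpoint all_leaves (G : graph) (P : tgraph G -> Prop) (tr : dtree G) : Prop :=
  match tr with
  | Leaf T => P T
  | SNode _ l r => all_leaves P l /\ all_leaves P r
  | PNode _ l r => all_leaves P l /\ all_leaves P r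
  end.

Definition all_proper (G : graph) (P : tgraph G -> Prop) (tr : dtree G) : Prop :=
  match tr with
  | Leaf _ => True
  | SNode _ l r => all_nodes P l /\ all_nodes P r
  | PNode _ l r => all_nodes P l /\ all_nodes P r
  end.

Definition maximal (G : graph) (tr : dtree G) : Prop := all_leaves (@prime_tg G) tr.

(* k pairwise edge-disjoint ta–tb paths inside T, each given by its edge set
   (a set of edges of T connecting ta to tb contains a ta–tb path). *)
Definition has_disj_paths (G : graph) (T : tgraph G) (k : nat) : bool :=
  [exists P : {ffun 'I_k -> {set gE G}},
     [forall i, (P i \subset tE T) && connect (adj (P i)) (ta T) (tb T)] &&
     [forall i, forall j, (i != j) ==> [disjoint P i & P j]]].

(* lambda_H(a,b); for a != b each path uses >= 1 edge so k <= #|E| *)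
Definition lam (G : graph) (T : tgraph G) : nat :=
  \max_(k < #|gE G|.+1 | has_disj_paths T k) k.

Definition mmf (G : graph) : nat :=
  \max_(x : gV G) \max_(y : gV G | y != x) lam (full x y).

Local Open Scope ring_scope.

Definition parc (F : fieldType) (a b : F) : F := (1 + a) * (1 + b) - 1.
Definition serq (F : fieldType) (q a b : F) : F := a * b / (q + a + b).

Definition Zpoly (F : fieldType) (G : graph) (q : F) (v : gE G -> F) : F :=
  \sum_(A : {set gE G}) q ^+ kcomp setT A * \prod_(e in A) v e.

Definition Apoly (F : fieldType) (G : graph) (q : F) (v : gE G -> F)
    (T : tgraph G) : F :=
  (q ^+ 2)^-1 * \sum_(A : {set gE G} | (A \subset tE T) &&
                        ~~ connect (adj A) (ta T) (tb T))
                   q ^+ kcomp (tV T) A * \prod_(e in A) v e.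

Definition Bpoly (F : fieldType) (G : graph) (q : F) (v : gE G -> F)
    (T : tgraph G) : F :=
  q^-1 * \sum_(A : {set gE G} | (A \subset tE T) &&
                   connect (adj A) (ta T) (tb T))
             q ^+ kcomp (tV T) A * \prod_(e in A) v e.

(* Main.v *)
Require Import Defs.
From HB Require Import structures.
From mathcomp Require Import all_boot all_order all_algebra zify ring.
Import Order.TTheory GRing.Theory Num.Theory.
Local Open Scope ring_scope.

(* For the first part, the effective weights satisfy v_eff = v_1 |><|_q v_2 at an s-node and
   v_eff = v_1 || v_2 at a p-node, while lambda is at least the minimum, respectively the sum, of
   the values at the children; nesting of the S_k then gives the claim by induction on the tree,
   once the prime leaves are known to be single edges.

   For the second part no decomposition tree is used. A series-parallel graph is reduced to a
   forest, each edge of a reduced graph standing for c(e) edge-disjoint paths of the original graph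
   and carrying a weight in S_(c(e)). A series reduction multiplies Z by q + v_1 + v_2, which is
   nonzero, and a parallel reduction leaves Z unchanged. The capacity can only exceed Lambda - 1
   when c(e) = Lambda, and then e is a bridge, for otherwise there would be Lambda + 1 disjoint
   paths; bridges merely need weights different from -q, because they contribute factors q + v_e. *)

(** Primality of a leaf only says that the leaf itself does not decompose, and the given tree need
    not follow the compositions by which [tsp] builds the graph. The link is [tg_module]: every
    constituent meets the rest of the graph only in its own terminals, a property that passes to
    children. Such a piece lies on one side of a composition or is itself cut by it, so a prime one
    is eventually confined to a single edge. In the second part the graph may be disconnected and
    comes without terminals, which is why reductions of the whole graph are convenient. A reduced
    graph forgets how many paths an edge represents; hence capacities are certified by path families
    in the fixed original graph, and its flow bound is the only one ever used. Bridges need extra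
    care: their weights may lie outside all the sets, so for two bridges in series q + v_1 + v_2 may
    vanish. There the local factor is (q + v_1)(q + v_2), and one bridge is split off while the
    other keeps its weight. *)

(** * Connectivity and component counts *)

Lemma connect_ind (T : finType) (r : rel T) (P : T -> Prop) x y :
  P x -> (forall u w, P u -> r u w -> P w) -> connect r x y -> P y.
Proof.
move=> Px Pr /connectP[p]; elim: p x Px => [|z p IHp] x Px /=; first by move=> _ ->.
by case/andP=> /(Pr _ _ Px)/IHp.
Qed.

Lemma joinsC (G : graph) (e : gE G) x y : joins e x y = joins e y x.
Proof. by rewrite /joins orbC. Qed.

Lemma joinsE (G : graph) (e : gE G) : joins e (gs e) (gt e).
Proof. by rewrite /joins !eqxx. Qed.

Lemma joins_ends {G : graph} {e : gE G} {x y} : joins e x y ->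
  (gs e = x /\ gt e = y) \/ (gs e = y /\ gt e = x).
Proof. by case/orP=> /andP[/eqP-> /eqP->]; [left|right]. Qed.

Lemma adjP (G : graph) (A : {set gE G}) x y :
  reflect (exists2 e, e \in A & joins e x y) (adj A x y).
Proof. exact: exists_inP. Qed.

Lemma adj_connect_sym (G : graph) (A : {set gE G}) : connect_sym (adj A).
Proof.
apply: sym_connect_sym => x y.
by apply/adjP/adjP=> -[e eA]; rewrite joinsC; exists e.
Qed.

Lemma joins_connect (G : graph) (A : {set gE G}) e x y :
  e \in A -> joins e x y -> connect (adj A) x y.
Proof. by move=> eA exy; apply/connect1/adjP; exists e. Qed.

(** Edges may be sent to connected pairs rather than to edges, so that the same lemma serves
    inclusions of edge sets, subdivided edges and the expansion of an edge into a path family. *)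
Lemma connect_hom (G H : graph) (f : gV G -> gV H)
    (A : {set gE G}) (B : {set gE H}) x y :
  (forall e, e \in A -> connect (adj B) (f (gs e)) (f (gt e))) ->
  connect (adj A) x y -> connect (adj B) (f x) (f y).
Proof.
move=> hf; elim/connect_ind; first exact: connect0.
move=> u w xu /adjP[e /hf eA euw]; apply: connect_trans xu _.
by case: (joins_ends euw) => -[<- <-] //; rewrite adj_connect_sym.
Qed.

Lemma connect_adjS (G : graph) (A B : {set gE G}) x y :
  A \subset B -> connect (adj A) x y -> connect (adj B) x y.
Proof.
move=> /subsetP AB; apply: (@connect_hom _ _ id) => e /AB eB.
exact: joins_connect eB (joinsE _ _).
Qed.

Lemma connect_adj0 (G : graph) (x y : gV G) : connect (adj set0) x y = (x == y).
Proof.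
apply/idP/eqP=> [|->]; last exact: connect0.
by elim/connect_ind=> // u w _ /adjP[e]; rewrite inE.
Qed.

(** A walk needs the new edge at most once, in one of two directions. *)
Lemma connect_adjU1 (G : graph) (A : {set gE G}) e x y u w : joins e x y ->
  connect (adj (e |: A)) u w =
    [|| connect (adj A) u w, connect (adj A) u x && connect (adj A) y w
      | connect (adj A) u y && connect (adj A) x w].
Proof.
move=> exy; have eA : e \in e |: A by rewrite !inE eqxx.
have cxy := joins_connect _ _ _ _ _ eA exy.
have sub : A \subset e |: A by apply: subsetUr.
apply/idP/idP; last first.
  case/or3P=> [|/andP[ux yw]|/andP[uy xw]]; first exact: connect_adjS.
    apply: connect_trans (connect_adjS _ _ _ _ _ sub ux) _.
    exact: connect_trans cxy (connect_adjS _ _ _ _ _ sub yw).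
  apply: connect_trans (connect_adjS _ _ _ _ _ sub uy) _.
  rewrite adj_connect_sym in cxy.
  exact: connect_trans cxy (connect_adjS _ _ _ _ _ sub xw).
elim/connect_ind; first by rewrite connect0.
move=> a b ih /adjP[e']; rewrite !inE => /orP[/eqP-> eab|e'A e'ab].
  have hs : ((a = x) /\ (b = y)) \/ ((a = y) /\ (b = x)).
    by case: (joins_ends exy) (joins_ends eab) => -[-> ->] [] [-> ->]; auto.
  case: hs ih => -[-> ->]; rewrite ?connect0 ?andbT ?andbF.
    by case/or3P=> [->|/andP[-> _]|->]; rewrite ?orbT.
  by case/or3P=> [->|->|/andP[-> _]]; rewrite ?orbT.
have cab := joins_connect _ _ _ _ _ e'A e'ab.
case/or3P: ih => [ua|/andP[-> yb]|/andP[-> xb]].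
- by rewrite (connect_trans ua cab).
- by rewrite (connect_trans yb cab) orbT.
by rewrite (connect_trans xb cab) !orbT.
Qed.

Lemma kcomp0 (G : graph) (VS : {set gV G}) : kcomp VS set0 = #|VS|.
Proof.
rewrite /kcomp card_in_imset // => x y xV yV /setP/(_ y).
by rewrite !inE !connect_adj0 eqxx yV /= => /eqP.
Qed.

(** The new edge either joins vertices already connected or merges exactly two classes. Only here
    and in [kcomp0] is [kcomp] unfolded; every later count adds edges one at a time. The sum form
    avoids truncated subtraction. *)
Lemma kcompU1 (G : graph) (VS : {set gV G}) (A : {set gE G}) e x y :
  joins e x y -> x \in VS -> y \in VS ->
  (kcomp VS (e |: A) + ~~ connect (adj A) x y)%N = kcomp VS A.
Proof.
move=> exy xV yV; rewrite /kcomp.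
have [cxy|ncxy] /= := boolP (connect (adj A) x y).
  rewrite addn0; congr #|pred_of_set _|; apply: eq_imset => u.
  apply/setP=> w; rewrite !inE (connect_adjU1 _ _ _ _ _ _ _ exy).
  congr (_ && _); apply/or3P/idP=> [[//|/andP[ux yw]|/andP[uy xw]]|]; last by constructor 1.
    exact: connect_trans ux (connect_trans cxy yw).
  rewrite adj_connect_sym in cxy.
  exact: connect_trans uy (connect_trans cxy xw).
pose cl u := [set w in VS | connect (adj A) u w].
pose cl' u := [set w in VS | connect (adj (e |: A)) u w].
rewrite -/(cl) -/(cl') addn1.
have csym := adj_connect_sym _ A.
have ceq u w : connect (adj A) u w -> cl u = cl w.
  by move=> uw; apply/setP=> z; rewrite !inE (same_connect csym uw).
have cin u w : w \in cl u -> cl w = cl u.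
  by rewrite inE => /andP[_ /ceq->].
have cself u : u \in VS -> u \in cl u by move=> uV; rewrite inE uV connect0.
have ncl : cl x != cl y.
  apply/eqP=> eq; have := cself _ yV; rewrite -eq inE yV.
  by rewrite (negbTE ncxy).
have xU : cl' x = cl x :|: cl y.
  apply/setP=> w; rewrite !inE (connect_adjU1 _ _ _ _ _ _ _ exy) connect0 (negbTE ncxy) /=.
  by rewrite orbF; case: (w \in VS).
have yU : cl' y = cl x :|: cl y.
  apply/setP=> w; rewrite !inE (connect_adjU1 _ _ _ _ _ _ _ exy) connect0.
  by rewrite [connect _ y x]csym (negbTE ncxy) /= orbC; case: (w \in VS).
have nU u : u \in VS -> cl u != cl x -> cl u != cl y -> cl' u = cl u.
  move=> uV ux uy; apply/setP=> w; rewrite !inE (connect_adjU1 _ _ _ _ _ _ _ exy).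
  case: (boolP (connect (adj A) u x)) => [/ceq h|_]; first by rewrite h eqxx in ux.
  case: (boolP (connect (adj A) u y)) => [/ceq h|_]; first by rewrite h eqxx in uy.
  by rewrite !orbF.
have xI : cl x \in [set cl u | u in VS] by apply/imsetP; exists x.
have yI : cl y \in [set cl u | u in VS] by apply/imsetP; exists y.
(* The classes of [x] and [y] disappear and their union is the only new class. *)
have -> : [set cl' u | u in VS] =
    (cl x :|: cl y) |: ([set cl u | u in VS] :\ cl x :\ cl y).
  apply/setP=> C; rewrite in_setU1 !in_setD1; apply/imsetP/idP.
    case=> u uV ->{C}.
    have [eux|nux] := eqVneq (cl u) (cl x).
      rewrite orbC; apply/orP; right; rewrite -xU; apply/eqP/setP=> w.
      have: connect (adj A) x u by move: (cself _ uV); rewrite eux inE uV.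
      move/(connect_adjS _ _ (e |: A) _ _ (subsetUr _ _)) => cxu.
      by rewrite !inE (same_connect (adj_connect_sym _ _) cxu).
    have [euy|nuy] := eqVneq (cl u) (cl y).
      rewrite orbC; apply/orP; right; rewrite -yU; apply/eqP/setP=> w.
      have: connect (adj A) y u by move: (cself _ uV); rewrite euy inE uV.
      move/(connect_adjS _ _ (e |: A) _ _ (subsetUr _ _)) => cyu.
      by rewrite !inE (same_connect (adj_connect_sym _ _) cyu).
    rewrite nU // nux nuy /=; apply/orP; right; exact: imset_f.
  case/orP=> [/eqP->|/and3P[ny nx /imsetP[u uV eC]]]; first by exists x.
  by exists u => //; rewrite nU // -eC.
rewrite [RHS](cardsD1 (cl x)) xI [in RHS](cardsD1 (cl y)) !in_setD1 eq_sym ncl yI.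
rewrite cardsU1 !in_setD1.
(* An old class containing both [x] and [y] would equal both [cl x] and [cl y], against [ncl]. *)
suff -> : (cl x :|: cl y) \in [set cl u | u in VS] = false by rewrite !andbF.
apply/negbTE/imsetP=> -[u uV eu].
have /cin ex: x \in cl u by rewrite -eu inE cself.
have /cin ey: y \in cl u by rewrite -eu inE [y \in cl y]cself ?orbT.
by rewrite ex ey eqxx in ncl.
Qed.

Lemma set_ind (T : finType) (P : {set T} -> Prop) :
  P set0 -> (forall x (A : {set T}), x \notin A -> P A -> P (x |: A)) -> forall A, P A.
Proof.
move=> P0 PU A; elim: {A}#|A| {-2}A (erefl #|A|) => [|n IHn] A.
  by move/eqP; rewrite cards_eq0 => /eqP->.
case: (set_0Vmem A) => [->|[x xA]]; first by rewrite cards0.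
rewrite (cardsD1 x) xA => -[cA]; rewrite -(setD1K xA); apply: PU; first by rewrite !inE eqxx.
exact: IHn.
Qed.

(** * Gluing edge sets along one or two vertices *)

Definition within (G : graph) (V : {set gV G}) (A : {set gE G}) :=
  forall e, e \in A -> (gs e \in V) && (gt e \in V).

Lemma within_joins {G : graph} {V : {set gV G}} {A e x y} :
  within G V A -> e \in A -> joins e x y -> x \in V /\ y \in V.
Proof. by move=> h /h /andP[gsV gtV] /joins_ends[] [<- <-]. Qed.

Lemma within_sub {G : graph} {V : {set gV G}} {A B : {set gE G}} :
  within G V A -> B \subset A -> within G V B.
Proof. by move=> h /subsetP BA e /BA/h. Qed.

Lemma within_setU1 {G : graph} {V : {set gV G}} {A e} :
  within G V (e |: A) -> [/\ gs e \in V, gt e \in V & within G V A].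
Proof.
move=> h; have /andP[-> ->] := h e (setU11 _ _).
by split=> //; apply: within_sub h (subsetUr _ _).
Qed.

(* [s = t] is allowed, so that this covers series as well as parallel composition. *)
Lemma connect_glue (G : graph) (V1 V2 : {set gV G}) (A1 A2 : {set gE G}) s t x y :
  V1 :&: V2 = [set s; t] -> within G V1 A1 -> within G V2 A2 ->
  x \in V2 -> y \in V2 ->
  connect (adj (A1 :|: A2)) x y =
  connect (adj A2) x y || connect (adj A1) s t &&
    (connect (adj A2) x s && connect (adj A2) t y
     || connect (adj A2) x t && connect (adj A2) s y).
Proof.
move=> V12 w1 w2 xV yV.
have sub1 u w : connect (adj A1) u w -> connect (adj (A1 :|: A2)) u w.
  by apply: connect_adjS; apply: subsetUl.
have sub2 u w : connect (adj A2) u w -> connect (adj (A1 :|: A2)) u w.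
  by apply: connect_adjS; apply: subsetUr.
have csym := adj_connect_sym _ A1.
apply/idP/idP; last first.
  case/orP=> [/sub2 //|/andP[st]]; have ts := st; rewrite csym in ts.
  case/orP=> /andP[xs ty].
    exact: connect_trans (sub2 _ _ xs) (connect_trans (sub1 _ _ st) (sub2 _ _ ty)).
  exact: connect_trans (sub2 _ _ xs) (connect_trans (sub1 _ _ ts) (sub2 _ _ ty)).
move=> cxy; pose R w := connect (adj A2) x w || connect (adj A1) s t &&
    (connect (adj A2) x s && connect (adj A2) t w
     || connect (adj A2) x t && connect (adj A2) s w).
have Rtrans a b : connect (adj A2) a b -> R a -> R b.
  rewrite /R => ab /orP[xa|/andP[-> /orP[/andP[-> ta]|/andP[-> sa]]]].
  - by rewrite (connect_trans xa ab).
  - by rewrite (connect_trans ta ab) orbT.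
  - by rewrite (connect_trans sa ab) !orbT.
have Rst : connect (adj A1) s t -> R s = R t.
  rewrite /R => ->; rewrite !connect0.
  by do 4!case: (connect (adj A2) _ _).
have Rp p u : p \in [set s; t] -> u \in [set s; t] -> connect (adj A1) p u -> R p -> R u.
  rewrite !inE => /orP[]/eqP-> /orP[]/eqP-> //; first by move/Rst->.
  by rewrite csym => /Rst->.
(* Invariant along a walk from [x]: inside [V2] the formula [R] holds, and inside [V1] the walk is
   connected within [A1] to a gluing vertex at which [R] holds. *)
have key : (y \in V2 /\ R y) \/
           (y \in V1 /\ exists p, [/\ p \in [set s; t], R p & connect (adj A1) p y]).
  elim/connect_ind: cxy; first by left; rewrite /R connect0.
  move=> a b IH /adjP[e]; rewrite inE => /orP[] eA eab.
    have [aV1 bV1] := within_joins w1 eA eab.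
    have cab := joins_connect _ _ _ _ _ eA eab.
    right; split=> //; case: IH => [[aV2 Ra]|[_ [p [pst Rpp pa]]]].
      by exists a; split=> //; rewrite -V12 inE aV1.
    by exists p; split=> //; apply: connect_trans pa cab.
  have [aV2 bV2] := within_joins w2 eA eab.
  have cab := joins_connect _ _ _ _ _ eA eab.
  left; split=> //; apply: Rtrans cab _.
  case: IH => [[_ //]|[aV1 [p [pst Rpp pa]]]].
  by apply: Rp pst _ pa Rpp; rewrite -V12 inE aV1.
case: key => [[_ //]|[yV1 [p [pst Rpp py]]]].
by apply: Rp pst _ py Rpp; rewrite -V12 inE yV1.
Qed.

(** Gluing identifies two pairs of vertices, and the second identification removes no component when
    both sides already connect [s] to [t]. For [s = t] the last summand is 1, which is the count for
    gluing at one vertex. *)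
Lemma kcomp_glue (G : graph) (V1 V2 : {set gV G}) (A1 A2 : {set gE G}) s t :
  V1 :&: V2 = [set s; t] -> within G V1 A1 -> within G V2 A2 ->
  (kcomp (V1 :|: V2) (A1 :|: A2) + 2 =
   kcomp V1 A1 + kcomp V2 A2 + (connect (adj A1) s t && connect (adj A2) s t))%N.
Proof.
move=> V12 w1; have sV : s \in V1 :&: V2 by rewrite V12 !inE eqxx.
have tV : t \in V1 :&: V2 by rewrite V12 !inE eqxx orbT.
elim/set_ind: A2 => [_|e A2 eA2 IH /within_setU1[xV yV w2]].
  rewrite setU0 kcomp0 connect_adj0.
  have -> : connect (adj A1) s t && (s == t) = (s == t).
    by rewrite andbC; case: eqP => // ->; rewrite connect0.
  elim/set_ind: A1 w1 => [_|e A1 eA1 IH /within_setU1[xV yV w1]].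
    rewrite !kcomp0 -cardsUI V12 cards2.
    by case: (s == t) => /=; lia.
  have {}IH := IH w1; have exy := joinsE _ e.
  have := kcompU1 _ V1 A1 _ _ _ exy xV yV.
  have := kcompU1 _ (V1 :|: V2) A1 _ _ _ exy; rewrite !inE xV yV => /(_ isT isT).
  by move: IH; case: (connect _ _ _); lia.
have {}IH := IH w2; have exy := joinsE _ e; set x := gs e in exy xV *; set y := gt e in exy yV *.
have := kcompU1 _ V2 A2 _ _ _ exy xV yV.
have := kcompU1 _ (V1 :|: V2) (A1 :|: A2) _ _ _ exy; rewrite !inE xV yV !orbT => /(_ isT isT).
rewrite (connect_glue _ _ _ _ _ _ _ _ _ V12 w1 w2 xV yV).
rewrite setUCA (connect_adjU1 _ _ _ _ _ _ _ exy).
have csym := adj_connect_sym _ A2; have ctr := @connect_trans _ (adj A2).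
(* [m] says that adding [e] makes [A2] connect [s] to [t], or that the ends of [e] already lie in
   the classes of [s] and [t]; under [m], [x] and [y] are connected in [A2] exactly when [s] and [t]
   are. *)
set m := connect (adj A2) x s && _ || _.
have -> : connect (adj A2) s x && connect (adj A2) y t ||
          connect (adj A2) s y && connect (adj A2) x t = m.
  by rewrite /m [connect _ s x]csym [connect _ y t]csym [X in _ || X]andbC.
have m_st : m -> connect (adj A2) x y -> connect (adj A2) s t.
  case/orP=> /andP[xs ty xy]; last rewrite csym; rewrite csym in xs;
    by apply: ctr xs (ctr _ _ _ xy _); rewrite csym.
have m_xy : m -> connect (adj A2) s t -> connect (adj A2) x y.
  case/orP=> /andP[] cs ct cst; first exact: ctr cs (ctr _ _ _ cst ct).
  by rewrite csym in cst; exact: ctr cs (ctr _ _ _ cst ct).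
move: m_st m_xy IH.
by case: m; case: (connect _ x y) => /=; case: (connect (adj A2) s t) => //=;
  case: (connect (adj A1) s t) => //= a b c d f;
  try (by have := a isT isT); try (by have := b isT isT); lia.
Qed.

(** Complements [connect_glue], where both end vertices lie on the same side: here the walk must
    pass from one side to the other through [w]. *)
Lemma connect_series (G : graph) (V1 V2 : {set gV G}) (A1 A2 : {set gE G}) w x y :
  V1 :&: V2 = [set w] -> within G V1 A1 -> within G V2 A2 ->
  x \in V1 -> y \in V2 ->
  connect (adj (A1 :|: A2)) x y = connect (adj A1) x w && connect (adj A2) w y.
Proof.
move=> V12 w1 w2 xV yV.
have inw u : u \in V1 -> u \in V2 -> u = w.
  by move=> u1 u2; apply/set1P; rewrite -V12 inE u1.
apply/idP/andP=> [cxy|[xw wy]]; last first.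
  apply: connect_trans (connect_adjS _ _ _ _ _ (subsetUl _ _) xw) _.
  exact: connect_adjS _ _ _ _ _ (subsetUr _ _) wy.
have : (y \in V1 /\ connect (adj A1) x y) \/
       [/\ y \in V2, connect (adj A1) x w & connect (adj A2) w y].
  elim/connect_ind: cxy; first by left; rewrite connect0.
  move=> a b IH /adjP[e]; rewrite inE => /orP[] eA eab.
    have [aV1 bV1] := within_joins w1 eA eab.
    have cab := joins_connect _ _ _ _ _ eA eab.
    left; split=> //; apply: connect_trans cab.
    by case: IH => [[]//|[aV2 cxw _]]; rewrite (inw a).
  have [aV2 bV2] := within_joins w2 eA eab.
  have cab := joins_connect _ _ _ _ _ eA eab.
  right; case: IH => [[aV1 xa]|[_ xw wa]].
    by rewrite -(inw a).
  by split=> //; apply: connect_trans wa cab.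
case=> [[yV1 xy]|[] //]; have yw := inw y yV1 yV.
by rewrite -yw connect0.
Qed.

(** * Partial Tutte polynomials of series and parallel compositions *)

Section PartialPolynomials.
Context {F : fieldType}.

Lemma sum_subsetU (E : finType) (E1 E2 : {set E}) (f : {set E} -> F) :
  E1 :&: E2 = set0 ->
  \sum_(A : {set E} | A \subset E1 :|: E2) f A =
  \sum_(A1 : {set E} | A1 \subset E1) \sum_(A2 : {set E} | A2 \subset E2) f (A1 :|: A2).
Proof.
move=> E12; have dis x : x \in E1 -> x \in E2 -> False.
  by move=> x1 x2; have := in_set0 x; rewrite -E12 inE x1 x2.
rewrite pair_big (reindex_onto (fun p : {set E} * {set E} => p.1 :|: p.2)
  (fun A => (A :&: E1, A :&: E2))) /=; last first.
  by move=> A AE; rewrite -setIUr; apply/setIidPl.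
apply: eq_bigl => -[A1 A2] /=; apply/andP/andP=> [[_ /eqP[<- <-]]|[s1 s2]].
  by rewrite !subsetIr.
split; first exact: setUSS.
apply/eqP; congr pair; apply/setP=> x; rewrite !inE.
  case: (boolP (x \in A1)) => [/(subsetP s1)->//|_] /=.
  by apply/negP=> /andP[/(subsetP s2) x2 x1]; apply: dis x2.
case: (boolP (x \in A2)) => [/(subsetP s2)->//|nx]; first by rewrite orbT.
by rewrite orbF; apply/negP=> /andP[/(subsetP s1) x2 x1]; apply: dis x1.
Qed.

Definition wt (G : graph) (q : F) (v : gE G -> F) (V : {set gV G}) (A : {set gE G}) : F :=
  q ^+ kcomp V A * \prod_(e in A) v e.

Lemma wt_glue (G : graph) (q : F) (v : gE G -> F) (V1 V2 : {set gV G})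
    (A1 A2 : {set gE G}) s t : q != 0 ->
  V1 :&: V2 = [set s; t] -> within G V1 A1 -> within G V2 A2 -> A1 :&: A2 = set0 ->
  wt G q v (V1 :|: V2) (A1 :|: A2) =
  q ^+ (connect (adj A1) s t && connect (adj A2) s t) / q ^+ 2 *
    (wt G q v V1 A1 * wt G q v V2 A2).
Proof.
move=> q0 V12 w1 w2 A12; rewrite /wt.
have := kcomp_glue _ _ _ _ _ _ _ V12 w1 w2.
set c := (_ && _); move/(congr1 (fun n => q ^+ n)); rewrite !exprD => h.
rewrite (big_setID A1) /= setUK (_ : (A1 :|: A2) :\: A1 = A2); last first.
  rewrite setDUl setDv set0U; apply/setDidPl.
  by rewrite -setI_eq0 setIC A12.
have {h}-> : q ^+ kcomp (V1 :|: V2) (A1 :|: A2) =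
    q ^+ kcomp V1 A1 * q ^+ kcomp V2 A2 * q ^+ c / q ^+ 2.
  by rewrite -h mulfK // expf_neq0.
set X := \prod_(_ in A1) _; set Y := \prod_(_ in A2) _.
set n1 := kcomp _ _; set n2 := kcomp _ _.
by move: (q ^+ n1) (q ^+ n2) ((q ^+ 2)^-1) (q ^+ c) => a b d f; ring.
Qed.

Lemma sum_connect (G : graph) (q : F) (v : gE G -> F) (T : tgraph G) (phi : bool -> F) :
  q != 0 ->
  \sum_(A : {set gE G} | A \subset tE T)
    phi (connect (adj A) (ta T) (tb T)) * wt G q v (tV T) A =
  phi false * (q ^+ 2 * Apoly q v T) + phi true * (q * Bpoly q v T).
Proof.
move=> q0; rewrite /Apoly /Bpoly !mulVKf ?expf_neq0 //.
rewrite (bigID (fun A : {set gE G} => connect (adj A) (ta T) (tb T))) /= addrC !mulr_sumr.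
by congr (_ + _); apply: eq_bigr => A /andP[_]; [move/negbTE->|move->].
Qed.

(** The test function [phi] selects [Apoly] or [Bpoly], so both recursions come from one
    computation. [psi] records how connection of the terminals and the power of [q] from [wt_glue]
    depend on the two parts. *)
Lemma sum_connect2 (G : graph) (q : F) (v : gE G -> F) (T T1 T2 : tgraph G)
    (phi : bool -> F) (psi : bool -> bool -> F) (s t : gV G) : q != 0 ->
  tV T = tV T1 :|: tV T2 -> tE T = tE T1 :|: tE T2 -> tE T1 :&: tE T2 = set0 ->
  tV T1 :&: tV T2 = [set s; t] ->
  within G (tV T1) (tE T1) -> within G (tV T2) (tE T2) ->
  (forall A1 A2 : {set gE G}, A1 \subset tE T1 -> A2 \subset tE T2 ->
    phi (connect (adj (A1 :|: A2)) (ta T) (tb T)) *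
      q ^+ (connect (adj A1) s t && connect (adj A2) s t) =
    psi (connect (adj A1) (ta T1) (tb T1)) (connect (adj A2) (ta T2) (tb T2))) ->
  phi false * (q ^+ 2 * Apoly q v T) + phi true * (q * Bpoly q v T) =
  (psi false false * (q ^+ 2 * Apoly q v T1) * (q ^+ 2 * Apoly q v T2)
   + psi false true * (q ^+ 2 * Apoly q v T1) * (q * Bpoly q v T2)
   + psi true false * (q * Bpoly q v T1) * (q ^+ 2 * Apoly q v T2)
   + psi true true * (q * Bpoly q v T1) * (q * Bpoly q v T2)) / q ^+ 2.
Proof.
move=> q0 eV eE E12 V12 w1 w2 hphi.
rewrite -sum_connect // eE sum_subsetU //.
(* The inner sum over [A2] depends on [A1] only through whether [A1] connects its terminals; [rho]
   is its value. *)
pose rho b1 := (psi b1 false * (q ^+ 2 * Apoly q v T2) + psi b1 true * (q * Bpoly q v T2)) / q ^+ 2.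
transitivity (\sum_(A1 : {set gE G} | A1 \subset tE T1)
    rho (connect (adj A1) (ta T1) (tb T1)) * wt G q v (tV T1) A1).
  apply: eq_bigr => A1 s1; rewrite /rho -sum_connect // mulr_suml mulr_suml.
  apply: eq_bigr => A2 s2; rewrite eV -hphi // (wt_glue _ _ _ _ _ _ _ _ _ q0 V12).
  - by move: (phi _) (q ^+ (_ && _)) => a b; ring.
  - exact: within_sub w1 s1.
  - exact: within_sub w2 s2.
  by apply/eqP; rewrite -subset0 -E12 setISS.
rewrite sum_connect // /rho; move: ((q ^+ 2)^-1) => q2; ring.
Qed.

Lemma wf_within (G : graph) (T : tgraph G) : wf_tg T -> within G (tV T) (tE T).
Proof. by case. Qed.

Lemma ABpoly_ser (G : graph) (q : F) (v : gE G -> F) (T T1 T2 : tgraph G) :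
  q != 0 -> ser_comp T T1 T2 ->
  Apoly q v T = q * Apoly q v T1 * Apoly q v T2 + Apoly q v T1 * Bpoly q v T2
                + Bpoly q v T1 * Apoly q v T2 /\
  Bpoly q v T = Bpoly q v T1 * Bpoly q v T2.
Proof.
move=> q0 [[wf1 wf2 [ea eb] em] [eV V12 eE E12]].
have [_ a1 _ w1] := wf1; have [_ _ b2 w2] := wf2.
(* Series composition is gluing along the degenerate pair [w], [w], so the exponent in [wt_glue] is
   always 1; this is the factor [q] in [psi]. *)
have V12' : tV T1 :&: tV T2 = [set tb T1; tb T1] by rewrite setUid.
have key phi := sum_connect2 G q v T T1 T2 phi (fun b1 b2 => phi (b1 && b2) * q) _ _ q0
   eV eE E12 V12' w1 w2.
have hc (A1 A2 : {set gE G}) : A1 \subset tE T1 -> A2 \subset tE T2 ->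
   connect (adj (A1 :|: A2)) (ta T) (tb T) =
   connect (adj A1) (ta T1) (tb T1) && connect (adj A2) (ta T2) (tb T2).
  move=> s1 s2; rewrite ea eb -em; apply: connect_series V12 _ _ a1 b2.
    exact: within_sub w1 s1.
  exact: within_sub w2 s2.
have hk (phi : bool -> F) (A1 A2 : {set gE G}) : A1 \subset tE T1 -> A2 \subset tE T2 ->
    phi (connect (adj (A1 :|: A2)) (ta T) (tb T)) *
      q ^+ (connect (adj A1) (tb T1) (tb T1) && connect (adj A2) (tb T1) (tb T1)) =
    phi (connect (adj A1) (ta T1) (tb T1) && connect (adj A2) (ta T2) (tb T2)) * q.
  by move=> s1 s2; rewrite hc // !connect0.
split.
  have := key (fun b => (~~ b)%:R) (hk _); rewrite /= => h.
  apply: (mulfI (expf_neq0 2 q0)); move: h; rewrite !mul0r !mul1r !addr0 => ->.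
  by field.
have := key (fun b => b%:R) (hk _); rewrite /= => h.
apply: (mulfI q0); move: h; rewrite !mul0r !mul1r !add0r => ->.
by field.
Qed.

Lemma ABpoly_par (G : graph) (q : F) (v : gE G -> F) (T T1 T2 : tgraph G) :
  q != 0 -> par_comp T T1 T2 ->
  Apoly q v T = Apoly q v T1 * Apoly q v T2 /\
  Bpoly q v T = Apoly q v T1 * Bpoly q v T2 + Bpoly q v T1 * Apoly q v T2
                + Bpoly q v T1 * Bpoly q v T2.
Proof.
move=> q0 [[wf1 wf2 [a1 a2] [b1 b2]] [eV V12 eE E12]].
have [_ _ _ w1] := wf1; have [_ aV bV w2] := wf2; rewrite a2 in aV; rewrite b2 in bV.
have key phi := sum_connect2 G q v T T1 T2 phi
   (fun b1 b2 => phi (b1 || b2) * q ^+ (b1 && b2)) _ _ q0 eV eE E12 V12 w1 w2.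
have hk (phi : bool -> F) (A1 A2 : {set gE G}) : A1 \subset tE T1 -> A2 \subset tE T2 ->
    phi (connect (adj (A1 :|: A2)) (ta T) (tb T)) *
      q ^+ (connect (adj A1) (ta T) (tb T) && connect (adj A2) (ta T) (tb T)) =
    phi (connect (adj A1) (ta T1) (tb T1) || connect (adj A2) (ta T2) (tb T2)) *
      q ^+ (connect (adj A1) (ta T1) (tb T1) && connect (adj A2) (ta T2) (tb T2)).
  move=> s1 s2; rewrite a1 a2 b1 b2; congr (phi _ * _).
  rewrite (connect_glue _ _ _ _ _ _ _ _ _ V12 (within_sub w1 s1) (within_sub w2 s2)) //.
  by rewrite !connect0 /= andbT orbC.
split.
  have := key (fun b => (~~ b)%:R) (hk _); rewrite /= => h.
  apply: (mulfI (expf_neq0 2 q0)); move: h; rewrite !mul0r !mul1r !addr0 => ->.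
  by field.
have := key (fun b => b%:R) (hk _); rewrite /= => h.
apply: (mulfI q0); move: h; rewrite !mul0r !mul1r !add0r => ->.
by field.
Qed.

Lemma ABpoly_edge (G : graph) (q : F) (v : gE G -> F) (T : tgraph G) e :
  q != 0 -> ta T != tb T -> tV T = [set ta T; tb T] -> tE T = [set e] ->
  joins e (ta T) (tb T) -> Apoly q v T = 1 /\ Bpoly q v T = v e.
Proof.
move=> q0 ab eV eE eab.
have ce : connect (adj [set e]) (ta T) (tb T) by apply: joins_connect eab; rewrite inE.
have nc : connect (adj (set0 : {set gE G})) (ta T) (tb T) = false.
  by rewrite connect_adj0 (negbTE ab).
have k0 : kcomp (tV T) set0 = 2%N by rewrite kcomp0 eV cards2 ab.
have k1 : kcomp (tV T) [set e] = 1%N.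
  have := kcompU1 _ (tV T) set0 _ _ _ eab.
  by rewrite eV !inE !eqxx orbT nc setU0 -eV k0 /= => /(_ isT isT); lia.
rewrite /Apoly /Bpoly eE; split.
  rewrite (big_pred1 set0) => [|A]; first by rewrite k0 big_set0 mulr1 mulVf ?expf_neq0 //.
  rewrite /= subset1; have [->|nA] := eqVneq A set0; first by rewrite orbT nc.
  by rewrite orbF; have [->|] := eqVneq A [set e]; rewrite // ce.
rewrite (big_pred1 [set e]) => [|A]; first by rewrite k1 big_set1 mulrA mulVf ?mul1r.
rewrite /= subset1; have [->|nA] := eqVneq A [set e]; first by rewrite ce.
by rewrite orFb; have [->|] := eqVneq A set0; rewrite // nc.
Qed.

End PartialPolynomials.

(** * Families of edge-disjoint paths *)

(** Indexing by [nat] instead of ['I_k] lets families be truncated, shifted and concatenated without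
    casts. *)
Definition path_family (G : graph) (X : {set gE G}) (x y : gV G) (k : nat) : Prop :=
  exists P : nat -> {set gE G},
    (forall i, (i < k)%N -> P i \subset X /\ connect (adj (P i)) x y) /\
    (forall i j, (i < k)%N -> (j < k)%N -> i != j -> [disjoint P i & P j]).

Lemma has_disj_pathsP (G : graph) (T : tgraph G) k :
  has_disj_paths T k <-> path_family G (tE T) (ta T) (tb T) k.
Proof.
split=> [/existsP[P /andP[/forallP hP /forallP dP]]|[P [hP dP]]].
  exists (fun i => oapp P set0 (insub i)); split=> [i ik|i j ik jk ij].
    by rewrite insubT /=; apply/andP.
  by rewrite !insubT /=; apply: (implyP (forallP (dP _) _)).
apply/existsP; exists [ffun i : 'I_k => P i]; apply/andP; split; apply/forallP=> i.
  by rewrite ffunE; apply/andP/hP.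
by apply/forallP=> j; apply/implyP=> ij; rewrite !ffunE dP.
Qed.

(** For [x != y] every member contains an edge, and disjointness makes a choice of such edges
    injective. This shows that the range of the maximum in [lam] is large enough. *)
Lemma path_family_leq (G : graph) (X : {set gE G}) x y k :
  x != y -> path_family G X x y k -> (k <= #|gE G|)%N.
Proof.
move=> xy [P [hP dP]].
have Pn i : (i < k)%N -> exists e, e \in P i.
  case/hP=> _ c; apply/set0Pn; apply: contraNneq xy => P0.
  by rewrite P0 connect_adj0 in c.
have Pc (i : 'I_k) : exists e, e \in P i by apply: Pn.
rewrite -[k]card_ord; apply: (@leq_card _ _ (fun i => xchoose (Pc i))) => i j eij.
apply/eqP/contraT=> nij; have := dP i j (ltn_ord _) (ltn_ord _) nij.
by move/disjointFr/(_ (xchooseP (Pc i))); rewrite eij (xchooseP (Pc j)).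
Qed.

Lemma lam_ge (G : graph) (T : tgraph G) k :
  ta T != tb T -> path_family G (tE T) (ta T) (tb T) k -> (k <= lam T)%N.
Proof.
move=> ab hk; have lek := path_family_leq _ _ _ _ _ ab hk.
by apply: (@leq_bigmax_cond _ _ (fun i : 'I_#|gE G|.+1 => i : nat) (Ordinal (lek : (k < _.+1)%N)));
   apply/has_disj_pathsP.
Qed.

Lemma lam_path_family (G : graph) (T : tgraph G) :
  path_family G (tE T) (ta T) (tb T) (lam T).
Proof.
apply/has_disj_pathsP; rewrite /lam.
elim/big_ind: _ => // [|x y hx hy]; last by rewrite /maxn; case: ifP.
by apply/has_disj_pathsP; exists (fun=> set0).
Qed.

Lemma path_family_cat (G : graph) (X Y : {set gE G}) x y z k l :
  [disjoint X & Y] ->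
  path_family G X x y k -> path_family G Y y z l ->
  path_family G (X :|: Y) x z (minn k l).
Proof.
move=> dXY [P [hP dP]] [Q [hQ dQ]]; exists (fun i => P i :|: Q i).
split=> [i|i j]; rewrite !leq_min => /andP[ik il].
  have [[PX cP] [QY cQ]] := (hP i ik, hQ i il); split; first exact: setUSS.
  apply: connect_trans (connect_adjS _ _ _ _ _ (subsetUl _ _) cP) _.
  exact: connect_adjS _ _ _ _ _ (subsetUr _ _) cQ.
case/andP=> jk jl ij; have [[Pi _] [Qi _]] := (hP i ik, hQ i il).
have [[Pj _] [Qj _]] := (hP j jk, hQ j jl).
rewrite -setI_eq0 setIUl !setIUr !setU_eq0 !setI_eq0 dP // dQ //= andbT.
by rewrite (disjointWl Pi) ?(disjointWr Qj) // disjoint_sym (disjointWl Pj) ?(disjointWr Qi).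
Qed.

Lemma path_familyD (G : graph) (X Y : {set gE G}) x y k l :
  [disjoint X & Y] ->
  path_family G X x y k -> path_family G Y x y l ->
  path_family G (X :|: Y) x y (k + l)%N.
Proof.
move=> dXY [P [hP dP]] [Q [hQ dQ]].
exists (fun i => if (i < k)%N then P i else Q (i - k)%N); split=> [i ikl|i j ikl jkl ij].
  case: ltnP => ik.
    by have [sP cP] := hP i ik; split=> //; apply: subset_trans sP (subsetUl _ _).
  have [|sQ cQ] := hQ (i - k)%N; first by lia.
  by split=> //; apply: subset_trans sQ (subsetUr _ _).
have dPQ a b : (a < k)%N -> (b < l)%N -> [disjoint P a & Q b].
  move=> /hP[Pa _] /hQ[Qb _]; exact: disjointWl Pa (disjointWr Qb dXY).
case: ltnP => ik; case: ltnP => jk.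
- exact: dP.
- by apply: dPQ => //; lia.
- by rewrite disjoint_sym; apply: dPQ => //; lia.
- by apply: dQ; lia.
Qed.

Lemma path_family_sym (G : graph) (X : {set gE G}) x y k :
  path_family G X x y k -> path_family G X y x k.
Proof.
by case=> P [hP dP]; exists P; split=> // i /hP; rewrite adj_connect_sym.
Qed.

Lemma path_familyS (G : graph) (X Y : {set gE G}) x y k :
  X \subset Y -> path_family G X x y k -> path_family G Y x y k.
Proof.
move=> XY [P [hP dP]]; exists P; split=> // i /hP[PX c]; split=> //.
exact: subset_trans PX XY.
Qed.

Lemma path_family1 (G : graph) (X : {set gE G}) x y :
  connect (adj X) x y -> path_family G X x y 1.
Proof.
by move=> c; exists (fun=> X); split=> [//|i j]; rewrite !ltnS !leqn0 => /eqP-> /eqP->.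
Qed.

Lemma path_family_connect (G : graph) (X : {set gE G}) x y k :
  (0 < k)%N -> path_family G X x y k -> connect (adj X) x y.
Proof. by move=> k0 [P [/(_ 0%N k0)[PX c] _]]; apply: connect_adjS PX c. Qed.

(** * Structure of 2-terminal series-parallel graphs and their prime modules *)

Lemma tsp_wf (G : graph) (T : tgraph G) : tsp T -> wf_tg T.
Proof.
elim=> {T} [T e ab eV eE eab|T T1 T2 _ wf1 _ wf2 [[_ _ [ea eb] em] [eV V12 eE _]]|
            T T1 T2 _ wf1 _ wf2 [[_ _ [ea _] [eb _]] [eV _ eE _]]].
- split=> //; rewrite ?eV ?eE ?inE ?eqxx ?orbT // => e'; rewrite inE => /eqP->.
  by rewrite !inE; case: (joins_ends eab) => -[-> ->]; rewrite !eqxx ?orbT.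
- case: wf1 wf2 => n1 a1 b1 w1 [n2 a2 b2 w2]; split; rewrite ?eV ?ea ?eb ?inE ?a1 ?b2 ?orbT //.
    apply: contra n1 => /eqP ab; have : tb T2 \in tV T1 :&: tV T2 by rewrite inE -ab a1 ab.
    by rewrite V12 inE => /eqP<-; apply/eqP.
  by move=> e; rewrite eE !inE => /orP[/w1|/w2] /andP[-> ->]; rewrite ?orbT.
case: wf1 wf2 => n1 a1 b1 w1 [n2 a2 b2 w2]; split; rewrite ?eV -?ea -?eb ?inE ?a1 ?b1 ?orbT //.
by move=> e; rewrite eE !inE => /orP[/w1|/w2] /andP[-> ->]; rewrite ?orbT.
Qed.

(* For [U] disjoint from [D], this says that [U] is a union of components of [T] minus [D]. *)
Definition closed_off (G : graph) (T : tgraph G) (D U : {set gV G}) : Prop :=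
  forall e x y, e \in tE T -> joins e x y -> x \in U -> (y \in U) || (y \in D).

Lemma closed_off_sub (G : graph) (T T' : tgraph G) (D D' U : {set gV G}) :
  wf_tg T' -> tE T' \subset tE T -> D :&: tV T' \subset D' ->
  closed_off G T D U -> closed_off G T' D' (U :&: tV T').
Proof.
move=> wf' /subsetP EE /subsetP DD cl e x y eE exy; rewrite !inE => /andP[xU xV].
have [_ yV] := within_joins (wf_within _ _ wf') eE exy.
rewrite yV andbT; case/orP: (cl _ _ _ (EE _ eE) exy xU) => [->//|yD].
by rewrite [y \in D']DD ?orbT // inE yD.
Qed.

(** This is connectedness in a form that passes to the parts of a composition: a closed set
    restricts to each part by intersection, whereas a path would have to be cut. *)
Lemma tsp_connected (G : graph) (T : tgraph G) : tsp T ->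
  forall U x, closed_off G T set0 U -> x \in U -> x \in tV T -> (ta T \in U) && (tb T \in U).
Proof.
elim=> {T} [T e ab eV eE eab|T T1 T2 t1 IH1 t2 IH2 [[wf1 wf2 [ea eb] em] [eV V12 eE _]]|
            T T1 T2 t1 IH1 t2 IH2 [[wf1 wf2 [ea1 ea2] [eb1 eb2]] [eV _ eE _]]] U x cl xU.
- have eT : e \in tE T by rewrite eE inE.
  have drop y z : joins e y z -> y \in U -> z \in U.
    by move=> eyz /(cl _ _ _ eT eyz); rewrite in_set0 orbF.
  rewrite eV !inE => /orP[]/eqP xE; rewrite -xE xU /= ?andbT; apply: drop xU.
    by rewrite xE.
  by rewrite xE joinsC.
- have IH1' y : y \in U -> y \in tV T1 -> (ta T1 \in U) && (tb T1 \in U).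
    move=> yU yV; have := IH1 (U :&: tV T1) y; rewrite !inE yU yV => /(_ _ isT isT)/andP[].
      by apply: closed_off_sub cl; rewrite ?eE ?subsetUl ?set0I.
    by move=> /andP[-> _] /andP[-> _].
  have IH2' y : y \in U -> y \in tV T2 -> (ta T2 \in U) && (tb T2 \in U).
    move=> yU yV; have := IH2 (U :&: tV T2) y; rewrite !inE yU yV => /(_ _ isT isT)/andP[].
      by apply: closed_off_sub cl; rewrite ?eE ?subsetUr ?set0I.
    by move=> /andP[-> _] /andP[-> _].
  have [_ _ b1 _] := wf1; have [_ a2 _ _] := wf2.
  rewrite eV inE ea eb => /orP[] xV.
    have /andP[-> wU] := IH1' _ xU xV; rewrite em in wU.
    by have /andP[_ ->] := IH2' _ wU a2.
  have /andP[wU ->] := IH2' _ xU xV; rewrite -em in wU.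
  by have /andP[-> _] := IH1' _ wU b1.
rewrite eV inE => /orP[] xV.
  have := IH1 (U :&: tV T1) x; rewrite !inE xU xV ea1 eb1 => /(_ _ isT isT)/andP[].
    by apply: closed_off_sub cl; rewrite ?eE ?subsetUl ?set0I.
  by move=> /andP[-> _] /andP[-> _].
have := IH2 (U :&: tV T2) x; rewrite !inE xU xV ea2 eb2 => /(_ _ isT isT)/andP[].
  by apply: closed_off_sub cl; rewrite ?eE ?subsetUr ?set0I.
by move=> /andP[-> _] /andP[-> _].
Qed.

(** Removing one terminal leaves every other vertex connected to the remaining terminal. In a series
    composition the part without the removed terminal is handled by [tsp_connected], the other by
    induction as far as the middle vertex. In a parallel composition induction applies to the part
    containing [x]. *)
Lemma tsp_cutvertex (G : graph) (T : tgraph G) : tsp T ->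
  forall (U : {set gV G}) x, x \in U -> x \in tV T ->
  (closed_off G T [set ta T] U -> ta T \notin U -> tb T \in U) /\
  (closed_off G T [set tb T] U -> tb T \notin U -> ta T \in U).
Proof.
elim=> {T} [T e ab eV eE eab|T T1 T2 t1 IH1 t2 IH2 [[wf1 wf2 [ea eb] em] [eV V12 eE _]]|
            T T1 T2 t1 IH1 t2 IH2 [[wf1 wf2 [ea1 ea2] [eb1 eb2]] [eV _ eE _]]] U x xU xV.
- move: xV; rewrite eV !inE => /orP[]/eqP xE; rewrite -xE xU; split=> // _; by rewrite xU.
- have [n1 a1 b1 _] := wf1; have [n2 a2 b2 _] := wf2.
  have nV2 : ta T1 \notin tV T2.
    by apply: contra n1 => aV; rewrite -in_set1 -V12 inE a1.
  have nV1 : tb T2 \notin tV T1.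
    by apply: contra n2 => bV; rewrite -em eq_sym -in_set1 -V12 inE bV.
  have s1 : tE T1 \subset tE T by rewrite eE subsetUl.
  have s2 : tE T2 \subset tE T by rewrite eE subsetUr.
  split=> cl nU.
    have cl2 : closed_off G T2 set0 (U :&: tV T2).
      apply: closed_off_sub wf2 s2 _ cl; apply/subsetP=> y; rewrite !inE ea.
      by case/andP=> /eqP->; rewrite (negbTE nV2).
    have use2 y : y \in U -> y \in tV T2 -> tb T \in U.
      move=> yU yV; have := tsp_connected _ _ t2 _ y cl2; rewrite !inE yU yV.
      by move=> /(_ isT isT) /andP[_ /andP[]]; rewrite eb.
    move: xV; rewrite eV inE => /orP[xV|]; last exact: use2.
    have [h _] := IH1 _ x (introT setIP (conj xU xV)) xV.
    have /setIP[wU _] : tb T1 \in U :&: tV T1.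
      apply: h; last by rewrite !inE negb_and -ea nU.
      by apply: closed_off_sub wf1 s1 _ cl; rewrite ea subsetIl.
    by apply: use2 wU _; rewrite em.
  have cl1 : closed_off G T1 set0 (U :&: tV T1).
    apply: closed_off_sub wf1 s1 _ cl; apply/subsetP=> y; rewrite !inE eb.
    by case/andP=> /eqP->; rewrite (negbTE nV1).
  have use1 y : y \in U -> y \in tV T1 -> ta T \in U.
    move=> yU yV; have := tsp_connected _ _ t1 _ y cl1; rewrite !inE yU yV.
    by move=> /(_ isT isT) /andP[/andP[]]; rewrite ea.
  move: xV; rewrite eV inE => /orP[|xV]; first exact: use1.
  have [_ h] := IH2 _ x (introT setIP (conj xU xV)) xV.
  have /setIP[wU _] : ta T2 \in U :&: tV T2.
    apply: h; last by rewrite !inE negb_and -eb nU.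
    by apply: closed_off_sub wf2 s2 _ cl; rewrite eb subsetIl.
  by apply: use1 wU _; rewrite -em.
have s1 : tE T1 \subset tE T by rewrite eE subsetUl.
have s2 : tE T2 \subset tE T by rewrite eE subsetUr.
move: xV; rewrite eV inE => /orP[]xV.
  have [h1 h2] := IH1 _ x (introT setIP (conj xU xV)) xV.
  move: h1 h2; rewrite ea1 eb1 => h1 h2; split=> cl nU.
    have /setIP[//] : tb T \in U :&: tV T1.
    apply: h1; last by rewrite !inE negb_and nU.
    by apply: closed_off_sub wf1 s1 _ cl; rewrite subsetIl.
  have /setIP[//] : ta T \in U :&: tV T1.
  apply: h2; last by rewrite !inE negb_and nU.
  by apply: closed_off_sub wf1 s1 _ cl; rewrite subsetIl.
have [h1 h2] := IH2 _ x (introT setIP (conj xU xV)) xV.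
move: h1 h2; rewrite ea2 eb2 => h1 h2; split=> cl nU.
  have /setIP[//] : tb T \in U :&: tV T2.
  apply: h1; last by rewrite !inE negb_and nU.
  by apply: closed_off_sub wf2 s2 _ cl; rewrite subsetIl.
have /setIP[//] : ta T \in U :&: tV T2.
apply: h2; last by rewrite !inE negb_and nU.
by apply: closed_off_sub wf2 s2 _ cl; rewrite subsetIl.
Qed.

Lemma connected_incident (G : graph) (T : tgraph G) x :
  wf_tg T -> connected_tg T -> x \in tV T -> exists e y, e \in tE T /\ joins e x y.
Proof.
move=> [ab aV bV _] cT xV.
have [z zV xz] : exists2 z, z \in tV T & x != z.
  by have [->|] := eqVneq x (ta T); [exists (tb T)|exists (ta T)].
case/connectP: (cT _ _ xV zV) => -[/= _ ez|y p /= /andP[/adjP[e eE exy] _] _].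
  by rewrite ez eqxx in xz.
by exists e, y.
Qed.

(** On a walk inside [T] from [e1] to [e2] the side can change only at a common vertex. *)
Lemma connected_crossing (G : graph) (T T1 T2 : tgraph G) e1 e2 :
  wf_tg T -> wf_tg T1 -> wf_tg T2 -> connected_tg T -> tE T \subset tE T1 :|: tE T2 ->
  e1 \in tE T -> e1 \in tE T1 -> e2 \in tE T -> e2 \in tE T2 ->
  exists2 z, z \in tV T & z \in tV T1 :&: tV T2.
Proof.
move=> wfT wf1 wf2 cT /subsetP sE e1T e11 e2T e22.
have [xV _] := within_joins (wf_within _ _ wfT) e1T (joinsE _ _).
have [yV _] := within_joins (wf_within _ _ wfT) e2T (joinsE _ _).
have [x1 _] := within_joins (wf_within _ _ wf1) e11 (joinsE _ _).
have [y2 _] := within_joins (wf_within _ _ wf2) e22 (joinsE _ _).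
case: (boolP [exists z in tV T, z \in tV T1 :&: tV T2]) => [/exists_inP//|].
rewrite negb_exists_in => /forall_inP nz.
suff y1 : gs e2 \in tV T1 by have := nz _ yV; rewrite inE y1 y2.
elim/connect_ind: (cT _ _ xV yV) => // u w u1 /adjP[e eT euw].
have [uV wV] := within_joins (wf_within _ _ wfT) eT euw.
have := sE _ eT; rewrite inE => /orP[] eE.
  by have [_ ->] := within_joins (wf_within _ _ wf1) eE euw.
have [u2 _] := within_joins (wf_within _ _ wf2) eE euw.
by have := nz _ uV; rewrite inE u1 u2.
Qed.

Definition restr (G : graph) (T : tgraph G) (H : tgraph G) a b : tgraph G :=
  TG (tV H :&: tV T) (tE H :&: tE T) a b.

Lemma restr_wf (G : graph) (T H : tgraph G) a b :
  wf_tg T -> wf_tg H -> a != b -> a \in tV H :&: tV T -> b \in tV H :&: tV T ->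
  wf_tg (restr G T H a b).
Proof.
move=> [_ _ _ wT] [_ _ _ wH] ab aV bV; split=> // e /=; rewrite !inE.
by case/andP=> /wH /andP[-> ->] /wT /andP[-> ->].
Qed.

(** The two restrictions of [H] form a series decomposition, and each is smaller because it misses
    one terminal of [H]. *)
Lemma not_prime_ser (G : graph) (H T1 T2 : tgraph G) w :
  wf_tg H -> wf_tg T1 -> wf_tg T2 ->
  tV T1 :&: tV T2 = [set w] -> tE T1 :&: tE T2 = set0 ->
  tV H \subset tV T1 :|: tV T2 -> tE H \subset tE T1 :|: tE T2 -> w \in tV H ->
  ta H \in tV T1 -> tb H \in tV T2 -> ta H != w -> tb H != w -> ~ prime_tg H.
Proof.
move=> wfH wf1 wf2 V12 E12 sV sE wV a1 b2 aw bw; apply.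
have [ab aV bV wH] := wfH.
have /setIP[w1 w2] : w \in tV T1 :&: tV T2 by rewrite V12 inE.
have a2 : ta H \notin tV T2 by apply: contra aw => a2; rewrite -in_set1 -V12 inE a1.
have b1 : tb H \notin tV T1 by apply: contra bw => b1; rewrite -in_set1 -V12 inE b1.
exists (restr G T1 H (ta H) w), (restr G T2 H w (tb H)); split.
- rewrite /tsize /= -addSn leq_add ?subset_leq_card ?subsetIl //.
  apply/proper_card/properP; split; first exact: subsetIl.
  by exists (tb H) => //; rewrite inE (negbTE b1) andbF.
- rewrite /tsize /= -addSn leq_add ?subset_leq_card ?subsetIl //.
  apply/proper_card/properP; split; first exact: subsetIl.
  by exists (ta H) => //; rewrite inE (negbTE a2) andbF.
left; split; split=> //=.
- by apply: restr_wf => //; rewrite inE ?aV ?a1 ?wV ?w1.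
- by apply: restr_wf => //; rewrite ?[w == _]eq_sym // inE ?bV ?b2 ?wV ?w2.
- by rewrite -setIUr; apply/esym/setIidPl.
- by rewrite setIACA setIid V12; apply/setIidPr; rewrite sub1set.
- by rewrite -setIUr; apply/esym/setIidPl.
- by rewrite setIACA setIid E12 setI0.
Qed.

(** One side may contain all vertices of [H], so here the decrease in size comes from the edges [e1]
    and [e2]. *)
Lemma not_prime_par (G : graph) (H T1 T2 : tgraph G) e1 e2 :
  wf_tg H -> wf_tg T1 -> wf_tg T2 ->
  tV T1 :&: tV T2 = [set ta H; tb H] -> tE T1 :&: tE T2 = set0 ->
  tV H \subset tV T1 :|: tV T2 -> tE H \subset tE T1 :|: tE T2 ->
  e1 \in tE H -> e1 \in tE T1 -> e2 \in tE H -> e2 \in tE T2 -> ~ prime_tg H.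
Proof.
move=> wfH wf1 wf2 V12 E12 sV sE e1H e11 e2H e22; apply.
have [ab aV bV wH] := wfH.
have /setIP[a1 a2] : ta H \in tV T1 :&: tV T2 by rewrite V12 !inE eqxx.
have /setIP[b1 b2] : tb H \in tV T1 :&: tV T2 by rewrite V12 !inE eqxx orbT.
have nE e : e \in tE T1 -> e \in tE T2 = false.
  by move=> h1; apply/negP=> h2; have := in_set0 e; rewrite -E12 inE h1 h2.
exists (restr G T1 H (ta H) (tb H)), (restr G T2 H (ta H) (tb H)); split.
- rewrite /tsize /= -addnS leq_add ?subset_leq_card ?subsetIl //.
  apply/proper_card/properP; split; first exact: subsetIl.
  by exists e2 => //; rewrite inE e2H /=; apply/negP=> /nE; rewrite e22.
- rewrite /tsize /= -addnS leq_add ?subset_leq_card ?subsetIl //.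
  apply/proper_card/properP; split; first exact: subsetIl.
  by exists e1 => //; rewrite inE e1H nE.
right; split; split=> //=.
- by apply: restr_wf => //; rewrite inE ?aV ?bV.
- by apply: restr_wf => //; rewrite inE ?aV ?bV.
- by rewrite -setIUr; apply/esym/setIidPl.
- by rewrite setIACA setIid V12; apply/setIidPr/subsetP=> x; rewrite !inE => /orP[]/eqP->.
- by rewrite -setIUr; apply/esym/setIidPl.
- by rewrite setIACA setIid E12 setI0.
Qed.

(* [H] is attached to the rest of [T] only at the terminals of [H]. *)
Definition tg_module (G : graph) (T H : tgraph G) : Prop :=
  [/\ tV H \subset tV T, tE H \subset tE T,
      forall x, x \in [set ta T; tb T] -> x \in tV H -> x \in [set ta H; tb H] &
      forall e x y, e \in tE T -> joins e x y -> x \in tV H -> x \notin [set ta H; tb H] ->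
        e \in tE H].

(** A new terminal of [T'] meets an edge of [T] outside [T']. Were it an inner vertex of [H], that
    edge would belong to [H] and hence to [T']. *)
Lemma tg_module_sub (G : graph) (T T' H : tgraph G) :
  wf_tg H -> connected_tg H -> wf_tg T' -> tE T' \subset tE T -> tE H \subset tE T' ->
  (forall x, x \in [set ta T'; tb T'] ->
     x \in [set ta T; tb T] \/ exists e y, [/\ e \in tE T, e \notin tE T' & joins e x y]) ->
  tg_module G T H -> tg_module G T' H.
Proof.
move=> wfH cH wf' sT' sH hT' [sV sE hT mod]; split=> //.
- apply/subsetP=> x /(connected_incident _ _ _ wfH cH)[e [y [eH exy]]].
  by have [] := within_joins (wf_within _ _ wf') (subsetP sH _ eH) exy.
- move=> x /hT'[xT|[e [y [eT neT' exy]]]]; first exact: hT.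
  by move=> xH; apply: contraNT neT' => nx; apply: (subsetP sH); apply: mod eT exy xH nx.
by move=> e x y /(subsetP sT'); apply: mod.
Qed.

Lemma tsp_incident (G : graph) (T : tgraph G) x :
  tsp T -> x \in [set ta T; tb T] -> exists e y, e \in tE T /\ joins e x y.
Proof.
move=> tT xT; have [ab aV bV _] := tsp_wf _ _ tT.
case: (boolP [exists e in tE T, exists y, joins e x y]) => [/exists_inP[e eT /existsP[y ey]]|].
  by exists e, y.
rewrite negb_exists_in => /forall_inP no.
have xV : x \in tV T by move: xT; rewrite !inE => /orP[]/eqP->.
have := tsp_connected _ _ tT [set x] x; rewrite !inE eqxx xV => /(_ _ isT isT)/andP[].
  move=> e u y eT euy; rewrite !inE => /eqP ux; case/negP: (no _ eT).
  by apply/existsP; exists y; rewrite -ux.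
by move=> /eqP h1 /eqP h2; rewrite h1 h2 eqxx in ab.
Qed.

(** Otherwise the vertices of [H] in [T'] other than [w] would all be inner to [H], so they would be
    closed off by [w]. By [cut] they would include a terminal of [T], which inside [H] can only be a
    terminal of [H]. *)
Lemma module_side (G : graph) (T T' H : tgraph G) e w :
  loopless G -> wf_tg H -> wf_tg T' -> tE T' \subset tE T -> tg_module G T H ->
  e \in tE H -> e \in tE T' ->
  (forall (U : {set gV G}) x, x \in U -> x \in tV T' -> closed_off G T' [set w] U ->
     w \notin U -> exists2 p, p \in [set ta T; tb T] & p \in U) ->
  exists p, [/\ p \in [set ta H; tb H], p \in tV T' & p != w].
Proof.
move=> lG wfH wf' s' [_ _ hT mod] eH eT cut.
have [x [xH xT xw]] : exists x, [/\ x \in tV H, x \in tV T' & x != w].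
  have [xH yH] := within_joins (wf_within _ _ wfH) eH (joinsE _ _).
  have [xT yT] := within_joins (wf_within _ _ wf') eT (joinsE _ _).
  have [xw|] := eqVneq (gs e) w; last by exists (gs e).
  by exists (gt e); split=> //; rewrite -xw eq_sym lG.
pose U := [set y in tV H :&: tV T' | y != w].
case: (boolP [exists p in [set ta H; tb H], (p \in tV T') && (p != w)]).
  by case/exists_inP=> p pH /andP[pT pw]; exists p.
rewrite negb_exists_in => /forall_inP np.
have [||||p pT] := cut U x; rewrite ?inE ?xH ?xT ?xw ?eqxx ?andbF //.
  move=> e' u y eT' euy; rewrite !inE => /andP[/andP[uH uT] uw].
  have [_ yT] := within_joins (wf_within _ _ wf') eT' euy.
  have eH' : e' \in tE H.
    apply: mod (subsetP s' _ eT') euy uH _.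
    by apply/negP=> /np; rewrite uT uw.
  have [_ ->] := within_joins (wf_within _ _ wfH) eH' euy.
  by rewrite yT /=; case: (y == w).
case/andP=> /andP[pH pT'] pw; have := np _ (hT _ pT pH).
by rewrite pT' pw.
Qed.

(* If [H] had edges on both sides of the last composition of [T], that composition would induce
   a decomposition of [H]; so [H] lies on one side, and finally in a single edge. *)
Lemma prime_module_edge (G : graph) (T H : tgraph G) :
  loopless G -> tsp T -> wf_tg H -> connected_tg H -> prime_tg H -> tg_module G T H ->
  exists e, [/\ tV H = [set ta H; tb H], tE H = [set e] & joins e (ta H) (tb H)].
Proof.
move=> lG tT wfH cH prH; have [abH aH bH wH] := wfH; elim: tT => {T}
  [T e ab eV eE eab|T T1 T2 t1 IH1 t2 IH2 [[wf1 wf2 [ea eb] em] [eV V12 eE E12]]|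
   T T1 T2 t1 IH1 t2 IH2 [[wf1 wf2 [ea1 ea2] [eb1 eb2]] [eV V12 eE E12]]] m.
- have [sV sE _ _] := m; rewrite eV in sV; rewrite eE in sE.
  have VH : tV H = [set ta H; tb H].
    apply/eqP; rewrite eq_sym eqEcard cards2 abH.
    rewrite (leq_trans (subset_leq_card sV)) ?cards2 ?leq_b1 ?andbT //; last by case: (_ != _).
    by apply/subsetP=> x; rewrite !inE => /orP[]/eqP->.
  have [e' [y [eH exy]]] := connected_incident _ _ _ wfH cH aH.
  have ee : e' = e by apply/set1P/(subsetP sE).
  rewrite ee in eH exy; exists e; split=> //.
    by apply/eqP; rewrite eqEsubset sE sub1set.
  have [_ ] := within_joins (wf_within _ _ wfH) eH exy.
  rewrite VH !inE => /orP[]/eqP ye; rewrite ye in exy => //.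
  by case: (joins_ends exy) => -[h1 h2]; have := lG e; rewrite h1 h2 eqxx.
- have [sV sE hT mod] := m; rewrite eV in sV; rewrite eE in sE.
  have s1 : tE T1 \subset tE T by rewrite eE subsetUl.
  have s2 : tE T2 \subset tE T by rewrite eE subsetUr.
  have [n1 a1 b1 w1] := wf1; have [n2 a2 b2 w2] := wf2.
  have notin e : e \in tE T1 -> e \in tE T2 -> False.
    by move=> h1 h2; have := in_set0 e; rewrite -E12 inE h1 h2.
  have [sub1|/subsetPn[e2 e2H ne2]] := boolP (tE H \subset tE T1).
    apply: IH1; apply: (tg_module_sub _ T) => // x; rewrite !inE -ea => /orP[/eqP->|/eqP->].
      by left; rewrite eqxx.
    have [|e [y [eT exy]]] := tsp_incident _ _ (ta T2) t2; first by rewrite !inE eqxx.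
    right; exists e, y; rewrite em; split=> //; first exact: (subsetP s2).
    by apply/negP=> /notin; apply.
  have [sub2|/subsetPn[e1 e1H ne1]] := boolP (tE H \subset tE T2).
    apply: IH2; apply: (tg_module_sub _ T) => // x; rewrite !inE -eb => /orP[/eqP->|/eqP->].
      have [|e [y [eT exy]]] := tsp_incident _ _ (tb T1) t1; first by rewrite !inE eqxx orbT.
      right; exists e, y; rewrite -em; split=> //; first exact: (subsetP s1).
      by apply/negP; apply: notin.
    by left; rewrite eqxx orbT.
  have e11 : e1 \in tE T1 by have := subsetP sE _ e1H; rewrite inE (negbTE ne1) orbF.
  have e22 : e2 \in tE T2 by have := subsetP sE _ e2H; rewrite inE (negbTE ne2).
  have [z zH] := connected_crossing _ _ _ _ _ _ wfH wf1 wf2 cH sE e1H e11 e2H e22.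
  rewrite V12 inE => /eqP zw; rewrite {}zw in zH; set w := tb T1 in em V12 zH.
  (* Each side holds a terminal of [H] other than [w], and [w] itself lies in [H]; so [H] is a
     series composition at [w], in one of the two orientations. *)
  have [p [pH pT1 pw]] : exists p, [/\ p \in [set ta H; tb H], p \in tV T1 & p != w].
    apply: (module_side G T T1 H e1) => // U x xU xV cl nU; exists (ta T); first by rewrite !inE eqxx.
    by rewrite ea; have [_ h] := tsp_cutvertex _ _ t1 _ _ xU xV; apply: h.
  have [p' [pH' pT2 pw']] : exists p, [/\ p \in [set ta H; tb H], p \in tV T2 & p != w].
    apply: (module_side G T T2 H e2) => // U x xU xV cl nU.
    exists (tb T); first by rewrite !inE eqxx orbT.
    by rewrite eb; have [h _] := tsp_cutvertex _ _ t2 _ _ xU xV; apply: h; rewrite -em.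
  have pp : p != p'.
    apply: contra pw => /eqP e; rewrite -in_set1 -V12 inE pT1 e //.
  exfalso; move: pH pH' pp pT1 pw pT2 pw'; rewrite !inE.
  case/orP=> /eqP-> /orP[]/eqP->; rewrite ?eqxx // => _ h1 h2 h3 h4.
    exact: (not_prime_ser G H T1 T2 w).
  by apply: (not_prime_ser G H T2 T1 w) prH; rewrite 1?setIC 1?setUC.
have [sV sE hT mod] := m; rewrite eV in sV; rewrite eE in sE.
have s1 : tE T1 \subset tE T by rewrite eE subsetUl.
have s2 : tE T2 \subset tE T by rewrite eE subsetUr.
have [sub1|/subsetPn[e2 e2H ne2]] := boolP (tE H \subset tE T1).
  by apply: IH1; apply: (tg_module_sub _ T) => // x; rewrite ea1 eb1; left.
have [sub2|/subsetPn[e1 e1H ne1]] := boolP (tE H \subset tE T2).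
  by apply: IH2; apply: (tg_module_sub _ T) => // x; rewrite ea2 eb2; left.
have e11 : e1 \in tE T1 by have := subsetP sE _ e1H; rewrite inE (negbTE ne1) orbF.
have e22 : e2 \in tE T2 by have := subsetP sE _ e2H; rewrite inE (negbTE ne2).
(* If the terminal [p] of [T] were missing from [H], each side would contain a terminal of [H] other
   than [p'], and these two would be distinct. But connectedness forces [p'] into [H], and as a
   terminal of [T] it would be a third terminal of [H]. *)
have ends p p' : [set p; p'] = [set ta T; tb T] ->
  (forall T' (U : {set gV G}) x, T' = T1 \/ T' = T2 -> x \in U -> x \in tV T' ->
     closed_off G T' [set p'] U -> p' \notin U -> p \in U) -> p \in tV H.
  move=> pp cut; apply/negPn/negP=> pnH.
  have pT : p \in [set ta T; tb T] by rewrite -pp !inE eqxx.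
  have pT' : p' \in [set ta T; tb T] by rewrite -pp !inE eqxx orbT.
  have [x [xH xT1 xp]] : exists x, [/\ x \in [set ta H; tb H], x \in tV T1 & x != p'].
    apply: (module_side G T T1 H e1) => // U x xU xV cl nU; exists p => //.
    by apply: (cut T1 U x) => //; left.
  have [y [yH yT2 yp]] : exists x, [/\ x \in [set ta H; tb H], x \in tV T2 & x != p'].
    apply: (module_side G T T2 H e2) => // U x' xU xV cl nU; exists p => //.
    by apply: (cut T2 U x') => //; right.
  have inH z : z \in [set ta H; tb H] -> z \in tV H.
    by rewrite !inE => /orP[]/eqP->.
  have np z : z \in [set ta H; tb H] -> z != p by move/inH=> zH; apply: contraNneq pnH => <-.
  have xy : x != y.
    apply/negP=> /eqP exy; have : x \in tV T1 :&: tV T2 by rewrite inE xT1 exy.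
    by rewrite V12 -pp !inE (negbTE (np _ xH)) (negbTE xp).
  have [z zH] := connected_crossing _ _ _ _ _ _ wfH wf1 wf2 cH sE e1H e11 e2H e22.
  rewrite V12 -pp !inE => /orP[]/eqP zp; first by rewrite -zp zH in pnH.
  have := hT _ pT'; rewrite -zp => /(_ zH).
  rewrite zp; move: xH yH xy xp yp; rewrite !inE.
  by case/orP=> /eqP-> /orP[]/eqP->; rewrite ?eqxx // => _ /negbTE h /negbTE h';
    rewrite ![p' == _]eq_sym h h'.
have sH : ta T \in tV H.
  apply: (ends _ (tb T)) => // T' U x [->|->] xU xV cl nU.
    by have [_] := tsp_cutvertex _ _ t1 _ _ xU xV; rewrite ea1 eb1; apply.
  by have [_] := tsp_cutvertex _ _ t2 _ _ xU xV; rewrite ea2 eb2; apply.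
have tH : tb T \in tV H.
  apply: (ends _ (ta T)) => [|T' U x [->|->] xU xV cl nU]; first by rewrite setUC.
    by have [+ _] := tsp_cutvertex _ _ t1 _ _ xU xV; rewrite ea1 eb1; apply.
  by have [+ _] := tsp_cutvertex _ _ t2 _ _ xU xV; rewrite ea2 eb2; apply.
have nT : ta T != tb T by case: wf1; rewrite ea1 eb1.
have eqT : [set ta T; tb T] = [set ta H; tb H].
  apply/eqP; rewrite eqEcard !cards2 abH nT leqnn andbT.
  by apply/subsetP=> x xT; apply: hT => //; move: xT; rewrite !inE => /orP[]/eqP->.
exfalso; rewrite eqT in V12.
exact: (not_prime_par G H T1 T2 e1 e2).
Qed.

(** An inner vertex of one child is absent from the other, so its edges stay in that child. Starting
    from the root, which is trivially a module of itself, the property thus reaches the prime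
    leaves. *)
Lemma tg_module_ser (G : graph) (T H H1 H2 : tgraph G) :
  ser_comp H H1 H2 -> tg_module G T H -> tg_module G T H1 /\ tg_module G T H2.
Proof.
case=> [[wf1 wf2 [ea eb] em] [eV V12 eE E12]] [sV sE hT mod].
have [_ a1 b1 w1] := wf1; have [_ a2 b2 w2] := wf2.
have inw x : x \in tV H1 -> x \in tV H2 -> x = tb H1.
  by move=> x1 x2; apply/set1P; rewrite -V12 inE x1.
rewrite eV subUset in sV; rewrite eE subUset in sE.
case/andP: sV sE => s1 s2 /andP[se1 se2].
split; split=> //.
- move=> x xT x1; have := hT x xT; rewrite eV ea eb !inE x1 => /(_ isT) /orP[->//|/eqP xb].
  by rewrite (inw x) ?eqxx ?orbT // xb.
- move=> e x y eT exy x1; rewrite !inE negb_or => /andP[xa xb].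
  have := mod e x y eT exy; rewrite eV ea eb eE !inE x1 negb_or xa /= => /(_ isT _)/orP[].
  - by apply: contra xb => /eqP xb; rewrite (inw x) // xb.
  - by [].
  by move/(fun h => within_joins w2 h exy)=> [x2 _]; rewrite (inw x) ?eqxx in xb.
- move=> x xT x2; have := hT x xT; rewrite eV ea eb !inE x2 orbT => /(_ isT).
  case/orP=> [/eqP xa|->]; last by rewrite orbT.
  by rewrite -em (inw x) ?eqxx // xa.
move=> e x y eT exy x2; rewrite !inE negb_or => /andP[xa xb].
have := mod e x y eT exy; rewrite eV ea eb eE !inE x2 orbT negb_or xb andbT /= => /(_ isT _)/orP[].
- by apply: contra xa => /eqP xa; rewrite -em (inw x) // xa.
- by move/(fun h => within_joins w1 h exy)=> [x1 _]; rewrite -em (inw x) ?eqxx in xa.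
by [].
Qed.

Lemma tg_module_par (G : graph) (T H H1 H2 : tgraph G) :
  par_comp H H1 H2 -> tg_module G T H -> tg_module G T H1 /\ tg_module G T H2.
Proof.
case=> [[wf1 wf2 [ea1 ea2] [eb1 eb2]] [eV V12 eE E12]] [sV sE hT mod].
have [_ _ _ w1] := wf1; have [_ _ _ w2] := wf2.
rewrite eV subUset in sV; rewrite eE subUset in sE.
case/andP: sV sE => s1 s2 /andP[se1 se2].
split; split; rewrite ?ea1 ?eb1 ?ea2 ?eb2 //.
- by move=> x xT x1; apply: hT; rewrite // eV inE x1.
- move=> e x y eT exy x1 xn; have xH : x \in tV H by rewrite eV inE x1.
  have := mod e x y eT exy xH xn; rewrite eE in_setU.
  case/orP=> // /(fun h => within_joins w2 h exy)[x2 _].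
  by rewrite -V12 inE x1 x2 in xn.
- by move=> x xT x2; apply: hT; rewrite // eV inE x2 orbT.
move=> e x y eT exy x2 xn; have xH : x \in tV H by rewrite eV inE x2 orbT.
have := mod e x y eT exy xH xn; rewrite eE in_setU.
case/orP=> // /(fun h => within_joins w1 h exy)[x1 _].
by rewrite -V12 inE x1 x2 in xn.
Qed.

(** * Effective weights along a decomposition tree *)

Lemma all_nodes_lab (G : graph) (P : tgraph G -> Prop) tr : all_nodes P tr -> P (lab tr).
Proof. by case: tr => [T|T l r|T l r] // []. Qed.

Lemma all_nodes_proper (G : graph) (P : tgraph G -> Prop) tr : all_nodes P tr -> all_proper P tr.
Proof. by case: tr => [T|T l r|T l r] // []. Qed.

Lemma valid_tree_lab (G : graph) (tr : dtree G) :
  valid_tree tr -> wf_tg (lab tr) /\ connected_tg (lab tr).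
Proof. by case: tr => [T|T l r|T l r] // []. Qed.

Lemma lam_gt0 (G : graph) (T : tgraph G) : wf_tg T -> connected_tg T -> (0 < lam T)%N.
Proof.
move=> [ab aV bV _] cT; apply: lam_ge => //; apply: path_family1; exact: cT.
Qed.

Lemma lam_ser (G : graph) (T T1 T2 : tgraph G) :
  wf_tg T -> ser_comp T T1 T2 -> (minn (lam T1) (lam T2) <= lam T)%N.
Proof.
move=> [ab _ _ _] [[_ _ [ea eb] em] [_ _ eE E12]]; apply: lam_ge => //.
rewrite eE ea eb; apply: path_family_cat; [|exact: lam_path_family|].
  by rewrite -setI_eq0 E12.
by rewrite em; apply: lam_path_family.
Qed.

Lemma lam_par (G : graph) (T T1 T2 : tgraph G) :
  wf_tg T -> par_comp T T1 T2 -> (lam T1 + lam T2 <= lam T)%N.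
Proof.
move=> [ab _ _ _] [[_ _ [ea1 ea2] [eb1 eb2]] [_ _ eE E12]]; apply: lam_ge => //.
rewrite eE; apply: path_familyD; first by rewrite -setI_eq0 E12.
  by rewrite -ea1 -eb1; apply: lam_path_family.
by rewrite -ea2 -eb2; apply: lam_path_family.
Qed.

Lemma nested_leq (T : Type) (S : nat -> T -> Prop) (m : nat) :
  (forall k, (1 <= k)%N -> (k < m)%N -> forall x, S k x -> S k.+1 x) ->
  forall k l x, (1 <= k)%N -> (k <= l)%N -> (l <= m)%N -> S k x -> S l x.
Proof.
move=> hS k l x k1; elim: l => [|l IHl]; first by rewrite leqn0 => /eqP->.
rewrite leq_eqVlt => /orP[/eqP->//|kl] lm Sk.
by apply: hS => //; [lia|apply: IHl => //; lia].
Qed.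

Section ConstituentWeights.
Context {F : numClosedFieldType} {q : F} {m : nat} {S : nat -> F -> Prop}.
Hypothesis q0 : q != 0.
Hypothesis S_nest : forall k, (1 <= k)%N -> (k < m)%N -> forall x, S k x -> S k.+1 x.
Hypothesis S_ser : forall k l, (1 <= k <= m)%N -> (1 <= l <= m)%N ->
  forall a b, S k a -> S l b -> q + a + b != 0 /\ S (minn k l) (serq q a b).
Hypothesis S_par : forall k l, (1 <= k)%N -> (1 <= l)%N -> (k + l <= m)%N ->
  forall a b, S k a -> S l b -> S (k + l)%N (parc a b).

Definition good_weight (G : graph) (v : gE G -> F) (T : tgraph G) : Prop :=
  (lam T <= m)%N -> Apoly q v T != 0 /\ S (lam T) (Bpoly q v T / Apoly q v T).

(** A child of an s-node can have larger [lam] than the node, so its bound must come from outside,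
    namely from the assumption on proper constituents. At a p-node [lam_par] passes the bound
    down. *)
Lemma good_weight_ser (G : graph) (v : gE G -> F) (T T1 T2 : tgraph G) :
  wf_tg T -> ser_comp T T1 T2 -> (0 < lam T1 <= m)%N -> (0 < lam T2 <= m)%N ->
  good_weight G v T1 -> good_weight G v T2 -> good_weight G v T.
Proof.
move=> wfT sT m1 m2 /(_ (proj2 (andP m1)))[A1 S1] /(_ (proj2 (andP m2)))[A2 S2] mT.
have [-> ->] := ABpoly_ser _ _ v _ _ _ q0 sT.
have [n0] := S_ser _ _ m1 m2 _ _ S1 S2.
move: (Apoly q v T1) (Bpoly q v T1) (Apoly q v T2) (Bpoly q v T2) A1 A2 n0 {S1 S2}.
move=> a1 b1 a2 b2 a10 a20 n0 SS.
(* In effective weights, [Apoly] of the series composition acquires the factor [q + v1 + v2], the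
   denominator of [serq]. *)
have eA : q * a1 * a2 + a1 * b2 + b1 * a2 = a1 * a2 * (q + b1 / a1 + b2 / a2).
  by field; rewrite ?a10 ?a20.
have A0 : a1 * a2 * (q + b1 / a1 + b2 / a2) != 0 by rewrite !mulf_neq0.
rewrite eA; split=> //.
have -> : b1 * b2 / (a1 * a2 * (q + b1 / a1 + b2 / a2)) = serq q (b1 / a1) (b2 / a2).
  by rewrite /serq invfM !mulrA; congr (_ / _); field; rewrite ?a10 ?a20.
apply: (nested_leq _ _ _ S_nest) _ _ _ _ (lam_ser _ _ _ _ wfT sT) mT SS; lia.
Qed.

Lemma good_weight_par (G : graph) (v : gE G -> F) (T T1 T2 : tgraph G) :
  wf_tg T -> par_comp T T1 T2 -> (0 < lam T1)%N -> (0 < lam T2)%N ->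
  good_weight G v T1 -> good_weight G v T2 -> good_weight G v T.
Proof.
move=> wfT pT m1 m2 g1 g2 mT; have lamT := lam_par _ _ _ _ wfT pT.
have [|A1 S1] := g1; first by lia.
have [|A2 S2] := g2; first by lia.
have [-> ->] := ABpoly_par _ _ v _ _ _ q0 pT.
have := S_par _ _ m1 m2 (leq_trans lamT mT) _ _ S1 S2.
move: (Apoly q v T1) (Bpoly q v T1) (Apoly q v T2) (Bpoly q v T2) A1 A2 {S1 S2 g1 g2}.
move=> a1 b1 a2 b2 a10 a20 SS; split; first by rewrite mulf_neq0.
have -> : (a1 * b2 + b1 * a2 + b1 * b2) / (a1 * a2) = parc (b1 / a1) (b2 / a2).
  by rewrite /parc; field; rewrite ?a10 ?a20.
apply: (nested_leq _ _ _ S_nest) _ _ _ _ lamT mT SS; lia.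
Qed.

Lemma good_weight_tree (G : graph) (s t : gV G) (v : gE G -> F) (tr : dtree G) :
  (0 < m)%N -> loopless G -> tsp (full s t) -> (forall e, S 1%N (v e)) ->
  valid_tree tr -> maximal tr -> tg_module G (full s t) (lab tr) ->
  all_proper (fun T => (lam T <= m)%N) tr ->
  all_nodes (good_weight G v) tr.
Proof.
move=> m0 lG tG hv; rewrite /maximal.
elim: tr => [T|T l IHl r IHr|T l IHl r IHr] /=.
- move=> [wfT cT] prT modT _ mT.
  (* The weight of the edge lies in [S 1]; positivity of [lam T] and nesting move it to
     [S (lam T)]. *)
  have [e [eV eE eab]] := prime_module_edge _ _ _ lG tG wfT cT prT modT.
  have [ab _ _ _] := wfT; have [-> ->] := ABpoly_edge _ _ v _ _ q0 ab eV eE eab.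
  rewrite oner_neq0 divr1; split=> //.
  by apply: (nested_leq _ _ _ S_nest) _ _ _ _ (lam_gt0 _ _ wfT cT) mT (hv e).
- move=> [wfT cT sT vl vr] [Ml Mr] /(tg_module_ser _ _ _ _ _ sT)[ml mr] [pl pr].
  have gl := IHl vl Ml ml (all_nodes_proper _ _ _ pl).
  have gr := IHr vr Mr mr (all_nodes_proper _ _ _ pr).
  have [wfl cl] := valid_tree_lab _ _ vl; have [wfr cr] := valid_tree_lab _ _ vr.
  split=> //; apply: (good_weight_ser _ _ _ _ _ wfT sT); try exact: all_nodes_lab.
    by rewrite lam_gt0 //; apply: all_nodes_lab pl.
  by rewrite lam_gt0 //; apply: all_nodes_lab pr.
move=> [wfT cT pT vl vr] [Ml Mr] /(tg_module_par _ _ _ _ _ pT)[ml mr] [pl pr].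
have gl := IHl vl Ml ml (all_nodes_proper _ _ _ pl).
have gr := IHr vr Mr mr (all_nodes_proper _ _ _ pr).
have [wfl cl] := valid_tree_lab _ _ vl; have [wfr cr] := valid_tree_lab _ _ vr.
split=> //; apply: (good_weight_par _ _ _ _ _ wfT pT); try exact: all_nodes_lab.
  exact: lam_gt0.
exact: lam_gt0.
Qed.

End ConstituentWeights.

(** * The Tutte polynomial under series and parallel reductions *)

Lemma joins_neq (G : graph) (e : gE G) x y : joins e x y -> (gs e != gt e) = (x != y).
Proof. by case/joins_ends=> -[-> ->] //; rewrite eq_sym. Qed.

Lemma sp_loopless (G : graph) : sp_graph G -> loopless G.
Proof.
elim=> {G} [G []//|G' G _ lG' [e' [w [e2 [f [g [[fi fw _] [[gi ge gsur] [hj h1 h2]]]]]]]]|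
            G' G _ lG' [e' [e2 [f [g [[/bij_inj fi gi ge gsur] [hj h2]]]]]]] e.
- have [->|/gsur[e0 <-]] := eqVneq e e2; first by rewrite (joins_neq _ _ _ _ h2) eq_sym fw.
  have [->|ne] := eqVneq e0 e'; first by rewrite (joins_neq _ _ _ _ h1) fw.
  by rewrite (joins_neq _ _ _ _ (hj _ ne)) (inj_eq fi) lG'.
have [->|/gsur[e0 <-]] := eqVneq e e2; first by rewrite (joins_neq _ _ _ _ h2) (inj_eq fi) lG'.
by rewrite (joins_neq _ _ _ _ (hj e0)) (inj_eq fi) lG'.
Qed.

Section Embedding.
Context {H G : graph} {f : gV H -> gV G} {g : gE H -> gE G} {B : {set gE H}}.
Hypothesis f_inj : injective f.
Hypothesis g_joins : forall e, e \in B -> joins (g e) (f (gs e)) (f (gt e)).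

(** Walks starting in the image of [f] stay there; in a subdivision this isolates the new vertex. *)
Lemma connect_imset_image x z :
  connect (adj (g @: B)) (f x) z -> exists2 y, z = f y & connect (adj B) x y.
Proof.
elim/connect_ind; first by exists x => //; apply: connect0.
move=> u w [y -> xy] /adjP[_ /imsetP[e eB ->]] euw.
have hs : exists2 y', w = f y' & joins e y y'.
  have hn := g_joins _ eB; move: euw hn.
  move=> /joins_ends[] [e1 e2] /joins_ends[] []; rewrite e1 e2 => h1 h2.
  - by exists (gt e) => //; rewrite (f_inj _ _ h1) joinsE.
  - by exists (gs e) => //; rewrite (f_inj _ _ h1) joinsC joinsE.
  - by exists (gs e) => //; rewrite (f_inj _ _ h2) joinsC joinsE.
  - by exists (gt e) => //; rewrite (f_inj _ _ h2) joinsE.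
have [y' -> ey] := hs; exists y' => //.
by apply: connect_trans xy _; apply: joins_connect eB ey.
Qed.

Lemma connect_imset x y : connect (adj (g @: B)) (f x) (f y) = connect (adj B) x y.
Proof.
apply/idP/idP=> [/connect_imset_image[z /f_inj->]//|].
apply: connect_hom => e eB; apply: joins_connect (g_joins _ eB); exact: imset_f.
Qed.

End Embedding.

(** Vertices outside the image of [f] are isolated, each a component of its own. *)
Lemma kcomp_imset (H G : graph) (f : gV H -> gV G) (g : gE H -> gE G) (B : {set gE H}) :
  injective f -> injective g ->
  (forall e, e \in B -> joins (g e) (f (gs e)) (f (gt e))) ->
  (kcomp setT (g @: B) + #|gV H| = kcomp setT B + #|gV G|)%N.
Proof.
move=> fi gi; elim/set_ind: B => [_|e B eB IH hj].
  by rewrite imset0 !kcomp0 !cardsT addnC.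
have hB e' : e' \in B -> joins (g e') (f (gs e')) (f (gt e')).
  by move=> e'B; apply: hj; rewrite inE e'B orbT.
have {}IH := IH hB.
have := kcompU1 _ setT B _ _ _ (joinsE _ e); rewrite !inE => /(_ isT isT).
have := kcompU1 _ setT (g @: B) _ _ _ (hj e (setU11 _ _)); rewrite !inE => /(_ isT isT).
rewrite (connect_imset fi hB) imsetU1.
by move=> h1 h2; move: IH; rewrite -h1 -h2 addnAC [RHS]addnAC => /addIn.
Qed.

Section TuttePolynomial.
Context {F : fieldType} {q : F}.

Lemma sum_subsetD1 (E : finType) (D : {set E}) e (f : {set E} -> F) : e \in D ->
  \sum_(A : {set E} | A \subset D) f A =
  \sum_(A : {set E} | A \subset D :\ e) (f A + f (e |: A)).
Proof.
move=> eD; rewrite -[in LHS](setD1K eD) setUC sum_subsetU; last first.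
  by apply/setP=> x; rewrite !inE; case: (x == e); rewrite ?andbF.
apply: eq_bigr => A _; rewrite (bigD1 set0) ?sub0set //= setU0; congr (_ + _).
rewrite (big_pred1 [set e]) => [|C] /=; first by rewrite setUC.
rewrite subset1; have [->|] := eqVneq C set0; last by rewrite orbF andbT.
by rewrite andbF eq_sym -subset0 sub1set inE.
Qed.

Lemma ZpolyE (G : graph) (v : gE G -> F) :
  Zpoly q v = \sum_(A : {set gE G} | A \subset setT) q ^+ kcomp setT A * \prod_(e in A) v e.
Proof. by apply: eq_bigl => A; rewrite subsetT. Qed.

Lemma prodU1 (E : finType) (v : E -> F) e (A : {set E}) : e \notin A ->
  \prod_(i in e |: A) v i = v e * \prod_(i in A) v i.
Proof. by move=> eA; rewrite big_setU1. Qed.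

Lemma subsetD1_notin (E : finType) (D A : {set E}) e : A \subset D :\ e -> e \notin A.
Proof. by rewrite subsetD1 => /andP[]. Qed.

(** The terms with and without [e] are both expressed by the component count with [e] present. When
    [e] is subdivided or doubled, this is also the count with both new edges present. *)
Lemma Zpoly_edge (G : graph) (v : gE G -> F) e :
  Zpoly q v = \sum_(A : {set gE G} | A \subset setT :\ e)
    q ^+ kcomp setT (e |: A) * (q ^+ (~~ connect (adj A) (gs e) (gt e)) + v e) *
      \prod_(i in A) v i.
Proof.
rewrite ZpolyE (sum_subsetD1 _ _ e) ?inE //; apply: eq_bigr => A /subsetD1_notin eA.
rewrite prodU1 // -(kcompU1 _ _ _ _ _ _ (joinsE _ e)) ?inE // exprD.
by move: (q ^+ _) (q ^+ _) => a b; ring.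
Qed.

Lemma Zpoly_edge2 (G : graph) (v : gE G -> F) e1 e2 : e1 != e2 ->
  Zpoly q v = \sum_(A : {set gE G} | A \subset setT :\ e2 :\ e1)
    (q ^+ kcomp setT A + v e1 * q ^+ kcomp setT (e1 |: A) + v e2 * q ^+ kcomp setT (e2 |: A)
     + v e1 * v e2 * q ^+ kcomp setT (e1 |: (e2 |: A))) * \prod_(i in A) v i.
Proof.
move=> e12; rewrite ZpolyE (sum_subsetD1 _ _ e2) ?inE //.
rewrite (sum_subsetD1 _ _ e1) ?inE ?e12 //; apply: eq_bigr => A hA.
have n1 := subsetD1_notin _ _ _ _ hA.
have n2 : e2 \notin A by apply: (@subsetD1_notin _ setT); apply: subset_trans hA (subsetDl _ _).
have n12 : e1 \notin e2 |: A by rewrite !inE negb_or e12.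
rewrite setUCA !prodU1 //; set P := \prod_(_ in A) _.
set k := kcomp setT A; set k1 := kcomp setT (e1 |: A); set k2 := kcomp setT (e2 |: A).
set k12 := kcomp setT (e1 |: _).
by move: (q ^+ k) (q ^+ k1) (q ^+ k2) (q ^+ k12) P => a b c d P; ring.
Qed.

Lemma sum_subset_imset (E E' : finType) (g : E -> E') (D : {set E}) (f : {set E'} -> F) :
  injective g ->
  \sum_(A : {set E'} | A \subset g @: D) f A = \sum_(B : {set E} | B \subset D) f (g @: B).
Proof.
move=> gi; rewrite (reindex_onto (fun B : {set E} => g @: B) (fun A => g @^-1: A)) /=.
  apply: eq_bigl => B; rewrite (_ : g @^-1: (g @: B) = B) ?eqxx ?andbT.
    by apply/idP/idP=> [|/imsetS//]; apply: contraTT => /subsetPn[x xB xD];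
      apply/subsetPn; exists (g x); [apply: imset_f|rewrite mem_imset].
  by apply/setP=> x; rewrite inE mem_imset.
move=> A /subsetP AD; apply/setP=> y; apply/imsetP/idP=> [[x]|yA].
  by rewrite inE => gA ->.
by case/imsetP: (AD _ yA) => x xD ye; exists x; rewrite // inE -ye.
Qed.

(* Both sums range over the sets [B] of edges other than [e']; they are compared term by term. *)
Lemma Zpoly_replace (H G : graph) (vH : gE H -> F) (v : gE G -> F)
    (g : gE H -> gE G) e' e2 (r : F) :
  injective g -> (forall e, g e != e2) -> (forall e, e != e2 -> exists e0, g e0 = e) ->
  (forall e, e != e' -> vH e = v (g e)) ->
  (forall B : {set gE H}, B \subset setT :\ e' ->
     let k := kcomp setT (e' |: B) in let c := connect (adj B) (gs e') (gt e') in
     q ^+ kcomp setT (g @: B) + v (g e') * q ^+ kcomp setT (g e' |: g @: B)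
     + v e2 * q ^+ kcomp setT (e2 |: g @: B)
     + v (g e') * v e2 * q ^+ kcomp setT (g e' |: (e2 |: g @: B)) =
     r * (q ^+ k * (q ^+ (~~ c) + vH e'))) ->
  Zpoly q v = r * Zpoly q vH.
Proof.
move=> gi ge2 gsur hv hB; rewrite (Zpoly_edge2 _ _ _ _ (ge2 e')) (Zpoly_edge _ _ e') mulr_sumr.
have -> : setT :\ e2 :\ g e' = g @: (setT :\ e').
  apply/setP=> e; rewrite !inE andbT; apply/andP/imsetP=> [[n1 /gsur[e0 ee]]|[e0 n ->]].
    by exists e0; rewrite // !inE andbT; apply: contra n1 => /eqP<-; rewrite ee.
  by rewrite ge2 (inj_eq gi); move: n; rewrite !inE andbT.
rewrite sum_subset_imset //; apply: eq_bigr => B sB; rewrite hB //= !mulrA.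
congr (_ * _); rewrite big_imset /=; last exact: in2W.
apply: eq_bigr => e eB; rewrite hv //; apply: contraTneq eB => ->.
exact: subsetD1_notin sB.
Qed.

Lemma kcompU1_setT (G : graph) (A : {set gE G}) e x y (c : bool) :
  joins e x y -> connect (adj A) x y = c -> (kcomp setT (e |: A) + ~~ c)%N = kcomp setT A.
Proof. by move=> exy <-; apply: kcompU1; rewrite ?inE. Qed.

Lemma Zpoly_par (H G : graph) (v : gE G -> F)
    (f : gV H -> gV G) (g : gE H -> gE G) e' e2 :
  bijective f -> injective g -> (forall e, g e != e2) ->
  (forall e, e != e2 -> exists e0, g e0 = e) ->
  (forall e, joins (g e) (f (gs e)) (f (gt e))) -> joins e2 (f (gs e')) (f (gt e')) ->
  Zpoly q v = Zpoly q (fun e => if e == e' then parc (v (g e')) (v e2) else v (g e)).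
Proof.
move=> fbij gi ge2 gsur hj h2; have fi := bij_inj fbij; rewrite -[RHS]mul1r.
apply: (Zpoly_replace _ _ _ _ g e' e2) => // [e /negbTE->//|B sB k c].
rewrite eqxx mul1r.
have hB e : e \in B -> joins (g e) (f (gs e)) (f (gt e)) by move=> _; apply: hj.
have hc : connect (adj (g @: B)) (f (gs e')) (f (gt e')) = c by apply: connect_imset.
have := kcomp_imset _ _ _ _ _ fi gi hB; rewrite (bij_eq_card fbij) => /addIn k0.
have := kcompU1_setT _ _ _ _ _ _ (joinsE _ e') (erefl c); rewrite -k0 -/k => k1.
have k2 := kcompU1_setT _ _ _ _ _ _ (hj e') hc.
have k3 := kcompU1_setT _ _ _ _ _ _ h2 hc.
have e2c : connect (adj (e2 |: g @: B)) (f (gs e')) (f (gt e')) = true.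
  by apply: joins_connect h2; rewrite !inE eqxx.
have := kcompU1_setT _ _ _ _ _ _ (hj e') e2c; rewrite /= addn0 => k4.
have ek2 : kcomp setT (g e' |: g @: B) = k by apply: (@addIn (~~ c)); rewrite k2.
have ek3 : kcomp setT (e2 |: g @: B) = k by apply: (@addIn (~~ c)); rewrite k3.
by rewrite k4 ek2 ek3 -k1 exprD /parc; move: (q ^+ k) (q ^+ (~~ c)) => a b; ring.
Qed.

(** Both series formulas come from the last bracket. It equals [(q + v1 + v2) * (q ^+ (~~ c) + serq
    q v1 v2)] if [q + v1 + v2] is nonzero, and for a bridge, where [c] is false, it factors as
    [(q + v1) * (q + v2)]. *)
Lemma Zpoly_ser_local (H G : graph) (v : gE G -> F)
    (f : gV H -> gV G) (g : gE H -> gE G) e' e2 w (B : {set gE H}) :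
  injective f -> (forall x, f x != w) -> (forall y, y != w -> exists x, f x = y) ->
  injective g -> (forall e, e != e' -> joins (g e) (f (gs e)) (f (gt e))) ->
  joins (g e') (f (gs e')) w -> joins e2 w (f (gt e')) -> B \subset setT :\ e' ->
  let k := kcomp setT (e' |: B) in let c := connect (adj B) (gs e') (gt e') in
  q ^+ kcomp setT (g @: B) + v (g e') * q ^+ kcomp setT (g e' |: g @: B)
  + v e2 * q ^+ kcomp setT (e2 |: g @: B)
  + v (g e') * v e2 * q ^+ kcomp setT (g e' |: (e2 |: g @: B)) =
  q ^+ k * (q ^+ (~~ c) * (q + v (g e') + v e2) + v (g e') * v e2).
Proof.
move=> fi fw fs gi hj h1 h2 sB k c.
have cV : #|gV G| = (#|gV H|).+1.
  rewrite -(card_codom fi) (cardD1 w) inE /= add1n; congr _.+1; apply: eq_card => y.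
  rewrite !inE andbT; apply/idP/idP=> [/fs[x <-]|/codomP[x ->]]; [exact: codom_f|exact: fw].
have hB e : e \in B -> joins (g e) (f (gs e)) (f (gt e)).
  move=> eB; apply: hj; apply: contraTneq eB => ->; exact: subsetD1_notin sB.
have hc : connect (adj (g @: B)) (f (gs e')) (f (gt e')) = c by apply: connect_imset.
have nw x : connect (adj (g @: B)) (f x) w = false.
  by apply/negP=> /(connect_imset_image fi hB)[y wy _]; have := fw y; rewrite wy eqxx.
have nw' x : connect (adj (g @: B)) w (f x) = false by rewrite adj_connect_sym.
have := kcomp_imset _ _ _ _ _ fi gi hB; rewrite cV addnS -addSn => /addIn k0.
have k1 := kcompU1_setT _ _ _ _ _ _ (joinsE _ e') (erefl c).
have := kcompU1_setT _ _ _ _ _ _ h1 (nw _); rewrite k0 -k1 addn1 -/k => -[k2].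
have := kcompU1_setT _ _ _ _ _ _ h2 (nw' _); rewrite k0 -k1 addn1 -/k => -[k3].
have e2c : connect (adj (e2 |: g @: B)) (f (gs e')) w = c.
  by rewrite (connect_adjU1 _ _ _ _ _ _ _ h2) nw hc connect0 /= andbT.
have := kcompU1_setT _ _ _ _ _ _ h1 e2c; rewrite k3 => /addIn k4.
rewrite k4 k2 exprS exprD.
by move: (q ^+ k) (q ^+ (~~ c)) => a b; ring.
Qed.

End TuttePolynomial.

Definition bridge (G : graph) (e : gE G) : bool :=
  ~~ connect (adj (setT :\ e)) (gs e) (gt e).

Section TuttePolynomialFactors.
Context {F : fieldType} {q : F}.

(** In a forest each edge lowers the component count by one, so the term of [A] is [q ^+ #|gV G|]
    times the product of [v e / q] over [A], and the sum factorises. *)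
Lemma Zpoly_forest (G : graph) (v : gE G -> F) : q != 0 -> forest G ->
  Zpoly q v = q ^+ #|gV G| * \prod_e (1 + v e / q).
Proof.
move=> q0 [_ br].
have kA (A : {set gE G}) : (kcomp setT A + #|A|)%N = #|gV G|.
  elim/set_ind: A => [|e A eA IH]; first by rewrite kcomp0 cards0 addn0 cardsT.
  have ne : connect (adj A) (gs e) (gt e) = false.
    apply: contraNF (br e); apply: connect_adjS.
    by rewrite subsetD1 subsetT eA.
  have := kcompU1_setT _ _ _ _ _ _ (joinsE _ e) ne; rewrite cardsU1 eA -IH => <-.
  by rewrite addnA.
under eq_bigr do rewrite addrC.
rewrite bigA_distr mulr_sumr; apply: eq_big => [A|A _]; first by rewrite inE.
rewrite -(kA A) exprD -mulrA; congr (_ * _).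
rewrite -big_mkcond /= prodf_div prodr_const mulrCA mulfV ?mulr1 //.
by rewrite expf_neq0.
Qed.

Lemma bridge_connect (G : graph) e (A : {set gE G}) :
  bridge G e -> A \subset setT :\ e -> connect (adj A) (gs e) (gt e) = false.
Proof. by move=> br sA; apply: contraNF br; apply: connect_adjS. Qed.

Lemma Zpoly_ser (H G : graph) (v : gE G -> F)
    (f : gV H -> gV G) (g : gE H -> gE G) e' e2 w :
  injective f -> (forall x, f x != w) -> (forall y, y != w -> exists x, f x = y) ->
  injective g -> (forall e, g e != e2) -> (forall e, e != e2 -> exists e0, g e0 = e) ->
  (forall e, e != e' -> joins (g e) (f (gs e)) (f (gt e))) ->
  joins (g e') (f (gs e')) w -> joins e2 w (f (gt e')) ->
  q + v (g e') + v e2 != 0 ->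
  Zpoly q v = (q + v (g e') + v e2) *
    Zpoly q (fun e => if e == e' then serq q (v (g e')) (v e2) else v (g e)).
Proof.
move=> fi fw fs gi ge2 gsur hj h1 h2 n0.
apply: (Zpoly_replace _ _ _ _ g e' e2) => // [e /negbTE->//|B sB k c].
rewrite (Zpoly_ser_local _ _ _ _ _ _ _ _ _ fi fw fs gi hj h1 h2 sB) eqxx -/k -/c /serq.
by move: (q ^+ k) (q ^+ (~~ c)) => a b; field.
Qed.

Lemma Zpoly_ser_bridge (H G : graph) (v : gE G -> F)
    (f : gV H -> gV G) (g : gE H -> gE G) e' e2 w :
  injective f -> (forall x, f x != w) -> (forall y, y != w -> exists x, f x = y) ->
  injective g -> (forall e, g e != e2) -> (forall e, e != e2 -> exists e0, g e0 = e) ->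
  (forall e, e != e' -> joins (g e) (f (gs e)) (f (gt e))) ->
  joins (g e') (f (gs e')) w -> joins e2 w (f (gt e')) ->
  bridge H e' ->
  Zpoly q v = (q + v e2) * Zpoly q (fun e => v (g e)).
Proof.
move=> fi fw fs gi ge2 gsur hj h1 h2 br.
apply: (Zpoly_replace _ _ _ _ g e' e2) => // B sB k c.
rewrite (Zpoly_ser_local _ _ _ _ _ _ _ _ _ fi fw fs gi hj h1 h2 sB) -/k -/c.
have -> : c = false by apply: bridge_connect.
by move: (q ^+ k) => a /=; ring.
Qed.

End TuttePolynomialFactors.

(** * Nonvanishing for series-parallel graphs of bounded maxmaxflow *)

Section SeriesParallel.
Context {F : numClosedFieldType} {q : F} {m : nat} {S : nat -> F -> Prop}.
Hypothesis q0 : q != 0.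
Hypothesis S_nest : forall k, (1 <= k)%N -> (k < m)%N -> forall x, S k x -> S k.+1 x.
Hypothesis S_ser : forall k l, (1 <= k <= m)%N -> (1 <= l <= m)%N ->
  forall a b, S k a -> S l b -> q + a + b != 0 /\ S (minn k l) (serq q a b).
Hypothesis S_par : forall k l, (1 <= k)%N -> (1 <= l)%N -> (k + l <= m)%N ->
  forall a b, S k a -> S l b -> S (k + l)%N (parc a b).
Hypothesis S_q : ~ S m (- q).
Hypothesis S_par_q : forall k l, (1 <= k)%N -> (1 <= l)%N -> (k + l)%N = m.+1 ->
  forall a b, S k a -> S l b -> parc a b != - q.

(* Series-parallel reductions preserve this: a parallel pair of total capacity [m + 1] can only
   be replaced by a bridge, and for a bridge the weight [-q] is the only bad one. *)
Definition edge_ok (G : graph) (v : gE G -> F) (c : gE G -> nat) (e : gE G) : Prop :=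
  ((c e <= m)%N /\ S (c e) (v e)) \/ (bridge G e /\ v e != - q).

(* Every edge [e] of [G] stands for [c e] edge-disjoint paths of [G0], all inside [X e]. *)
Definition blow_up (G0 G : graph) (phi : gV G -> gV G0) (X : gE G -> {set gE G0})
    (c : gE G -> nat) : Prop :=
  [/\ injective phi, forall e e', e != e' -> [disjoint X e & X e'],
      forall e, (0 < c e)%N &
      forall e, path_family G0 (X e) (phi (gs e)) (phi (gt e)) (c e)].

Lemma path_family_joins (G0 G : graph) (phi : gV G -> gV G0) (X : {set gE G0}) k (e : gE G) x y :
  path_family G0 X (phi (gs e)) (phi (gt e)) k -> joins e x y ->
  path_family G0 X (phi x) (phi y) k.
Proof.
by move=> h /joins_ends[] [<- <-] //; apply: path_family_sym.
Qed.

Lemma edge_ok_neq (G : graph) (v : gE G -> F) (c : gE G -> nat) e :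
  (0 < c e)%N -> edge_ok G v c e -> q + v e != 0.
Proof.
move=> c0 ok; rewrite addrC addr_eq0; case: ok => [[cm Sc]|[]//].
apply/eqP=> veq; apply: S_q; rewrite -veq.
exact: (nested_leq _ _ _ S_nest) c0 cm (leqnn _) Sc.
Qed.

(** The induction varies the reduced graph, its weights and its capacities, while [G0] and its flow
    bound stay fixed; disjoint paths of a reduced graph are moved to [G0] through [phi] and [X]. *)
Lemma Zpoly_series_parallel (G0 G : graph) (phi : gV G -> gV G0) (X : gE G -> {set gE G0})
    (c : gE G -> nat) (v : gE G -> F) :
  (forall x y k, x != y -> path_family G0 setT x y k -> (k <= m.+1)%N) ->
  sp_graph G -> blow_up G0 G phi X c -> (forall e, edge_ok G v c e) ->
  Zpoly q v != 0.
Proof.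
move=> flow spG; elim: spG phi X c v => {G}
  [G fG|G' G spG IH [e' [w [e2 [f [g [[fi fw fs] [[gi ge2 gsur] [hj h1 h2]]]]]]]]|
   G' G spG IH [e' [e2 [f [g [[fb gi ge2 gsur] [hj h2]]]]]]] phi X c v [phii dX c0 hX] ok.
- rewrite Zpoly_forest // mulf_neq0 ?expf_neq0 //; apply/prodf_neq0 => e _.
  have := edge_ok_neq _ _ _ _ (c0 e) (ok e); apply: contraNneq => h.
  have -> : q + v e = q * (1 + v e / q) by field.
  by rewrite h mulr0.
- set e1 := g e' in h1; have n12 : e1 != e2 by apply: ge2.
  pose X' e := if e == e' then X e1 :|: X e2 else X (g e).
  pose c' e := if e == e' then minn (c e1) (c e2) else c (g e).
  have bl : blow_up G0 G' (phi \o f) X' c'.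
    split=> [|a b ab|e|e].
    - exact: inj_comp.
    - rewrite /X'; have [ea|na] := eqVneq a e'; have [eb|nb] := eqVneq b e'.
      + by rewrite ea eb eqxx in ab.
      + by rewrite -setI_eq0 setIUl setU_eq0 !setI_eq0 !dX // 1?eq_sym // (inj_eq gi).
      + by rewrite disjoint_sym -setI_eq0 setIUl setU_eq0 !setI_eq0 !dX // 1?eq_sym // (inj_eq gi).
      + by rewrite dX // (inj_eq gi).
    - by rewrite /c'; case: eqP => // _; rewrite leq_min !c0.
    rewrite /c' /X' /=; have [->|ne] := eqVneq e e'; last first.
      exact: path_family_joins (hX _) (hj _ ne).
    apply: path_family_cat (dX _ _ n12) _ _.
      exact: path_family_joins (hX _) h1.
    exact: path_family_joins (hX _) h2.
  (* A path of [G'] avoiding [e] lifts to [G] with [e'] subdivided, so other bridges remain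
     bridges. *)
  have brE e : e != e' -> bridge G (g e) -> bridge G' e.
    move=> ne; apply: contra => con.
    have : connect (adj (setT :\ g e)) (f (gs e)) (f (gt e)).
      apply: connect_hom con => a; rewrite !inE andbT => ae.
      have [->|na] := eqVneq a e'; last first.
        by apply: joins_connect (hj _ na); rewrite !inE andbT (inj_eq gi).
      apply: (@connect_trans _ _ w); first apply: joins_connect h1.
        by rewrite !inE andbT (inj_eq gi) eq_sym.
      by apply: joins_connect h2; rewrite !inE andbT eq_sym ge2.
    by case: (joins_ends (hj _ ne)) => -[-> ->] //; rewrite adj_connect_sym.
  have okE v' e : e != e' -> v' e = v (g e) -> edge_ok G' v' c' e.
    rewrite /edge_ok /c' => ne ->; rewrite (negbTE ne).
    by case: (ok (g e)) => [|[br nv]]; [left|right; split=> //; apply: brE].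
  have [br|nbr] := boolP (bridge G' e').
    rewrite (Zpoly_ser_bridge _ _ _ _ _ _ _ _ fi fw fs gi ge2 gsur hj h1 h2 br).
    rewrite mulf_neq0 ?(edge_ok_neq _ _ _ _ (c0 e2) (ok e2)) //.
    apply: IH bl _ => e; have [->|ne] := eqVneq e e'; last exact: okE.
    right; split=> //; have := edge_ok_neq _ _ _ _ (c0 e1) (ok e1).
    by rewrite addrC addr_eq0.
  (* Now [e'] lies on a cycle, hence so do [e1] and [e2]; neither is a bridge, and only the first
     alternative of [edge_ok] remains for them. *)
  have con : connect (adj (setT :\ e1 :\ e2)) (f (gs e')) (f (gt e')).
    rewrite negbK in nbr; apply: connect_hom nbr => a; rewrite !inE andbT => ae.
    by apply: joins_connect (hj _ ae); rewrite !inE andbT ge2 (inj_eq gi).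
  have nb1 : ~~ bridge G e1.
    rewrite negbK.
    have : connect (adj (setT :\ e1)) (f (gs e')) w.
      apply: connect_trans (connect_adjS _ _ _ _ _ (subsetDl _ _) con) _.
      by rewrite adj_connect_sym; apply: joins_connect h2; rewrite !inE andbT eq_sym.
    by case: (joins_ends h1) => -[-> ->] //; rewrite adj_connect_sym.
  have nb2 : ~~ bridge G e2.
    rewrite negbK.
    have : connect (adj (setT :\ e2)) w (f (gt e')).
      apply: (@connect_trans _ _ (f (gs e'))).
        by rewrite adj_connect_sym; apply: joins_connect h1; rewrite !inE andbT.
      by apply: connect_adjS con; apply/subsetP=> a; rewrite !inE => /andP[-> _].
    by case: (joins_ends h2) => -[-> ->] //; rewrite adj_connect_sym.
  have [cm1 S1] : (c e1 <= m)%N /\ S (c e1) (v e1).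
    by case: (ok e1) => // -[br]; rewrite br in nb1.
  have [cm2 S2] : (c e2 <= m)%N /\ S (c e2) (v e2).
    by case: (ok e2) => // -[br]; rewrite br in nb2.
  have [||n0 SS] := S_ser (c e1) (c e2) _ _ _ _ S1 S2; rewrite ?c0 //.
  rewrite (Zpoly_ser _ _ _ _ _ _ _ _ fi fw fs gi ge2 gsur hj h1 h2 n0) mulf_neq0 //.
  apply: IH bl _ => e; have [ee|ne] := eqVneq e e'; last by apply: okE; rewrite // (negbTE ne).
  by left; rewrite ee /c' !eqxx; split=> //; rewrite geq_min cm1.
set e1 := g e'; have n12 : e1 != e2 by apply: ge2.
have fi := bij_inj fb.
pose X' e := if e == e' then X e1 :|: X e2 else X (g e).
pose c' e := if e == e' then (c e1 + c e2)%N else c (g e).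
have bl : blow_up G0 G' (phi \o f) X' c'.
  split=> [|a b ab|e|e].
  - exact: inj_comp.
  - rewrite /X'; have [ea|na] := eqVneq a e'; have [eb|nb] := eqVneq b e'.
    + by rewrite ea eb eqxx in ab.
    + by rewrite -setI_eq0 setIUl setU_eq0 !setI_eq0 !dX // 1?eq_sym // (inj_eq gi).
    + by rewrite disjoint_sym -setI_eq0 setIUl setU_eq0 !setI_eq0 !dX // 1?eq_sym // (inj_eq gi).
    + by rewrite dX // (inj_eq gi).
  - by rewrite /c'; case: eqP => // _; rewrite addn_gt0 c0.
  rewrite /c' /X' /=; have [->|ne] := eqVneq e e'; last first.
    exact: path_family_joins (hX _) (hj _).
  apply: path_familyD (dX _ _ n12) _ _.
    exact: path_family_joins (hX _) (hj _).
  exact: path_family_joins (hX _) h2.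
(* Each of two parallel edges bypasses the other, so neither is a bridge. *)
have con12 (e3 : gE G) : e3 = e1 \/ e3 = e2 ->
    connect (adj (setT :\ e3)) (f (gs e')) (f (gt e')).
  case=> ->; first by apply: joins_connect h2; rewrite !inE andbT eq_sym.
  by apply: joins_connect (hj e'); rewrite !inE andbT.
have brE e : e != e' -> bridge G (g e) -> bridge G' e.
  move=> ne; apply: contra => con.
  have : connect (adj (setT :\ g e)) (f (gs e)) (f (gt e)).
    apply: connect_hom con => a; rewrite !inE andbT => ae.
    by apply: joins_connect (hj a); rewrite !inE andbT (inj_eq gi).
  by case: (joins_ends (hj e)) => -[-> ->] //; rewrite adj_connect_sym.
have nb1 : ~~ bridge G e1.
  rewrite negbK; have := con12 e1 (or_introl erefl).
  by case: (joins_ends (hj e')) => -[-> ->] //; rewrite adj_connect_sym.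
have nb2 : ~~ bridge G e2.
  rewrite negbK; have := con12 e2 (or_intror erefl).
  by case: (joins_ends h2) => -[-> ->] //; rewrite adj_connect_sym.
have [cm1 S1] : (c e1 <= m)%N /\ S (c e1) (v e1).
  by case: (ok e1) => // -[br]; rewrite br in nb1.
have [cm2 S2] : (c e2 <= m)%N /\ S (c e2) (v e2).
  by case: (ok e2) => // -[br]; rewrite br in nb2.
rewrite (Zpoly_par _ _ _ _ _ _ _ fb gi ge2 gsur hj h2).
have [phii' dX' c0' hX'] := bl.
have n' : (phi \o f) (gs e') != (phi \o f) (gt e').
  by rewrite (inj_eq phii') (sp_loopless _ spG).
(* The merged edge carries disjoint paths of [G0] between distinct vertices, so the total capacity
   exceeds [m] by at most one; the borderline case is the one covered by [S_par_q]. *)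
have c12 : (c e1 + c e2 <= m.+1)%N.
  apply: (flow _ _ _ n'); have := hX' e'; rewrite /c' eqxx.
  by apply: path_familyS; apply: subsetT.
apply: IH bl _ => e; have [ee|ne] := eqVneq e e'; last first.
  rewrite /edge_ok /c' (negbTE ne).
  by case: (ok (g e)) => [|[br nv]]; [left|right; split=> //; apply: brE].
rewrite /edge_ok {}ee /c' !eqxx.
have [le|gt] := leqP (c e1 + c e2) m; first by left; split=> //; apply: S_par.
have c12m : (c e1 + c e2)%N = m.+1 by apply/eqP; rewrite eqn_leq c12.
right; split; last exact: S_par_q c12m _ _ S1 S2.
(* Otherwise a path avoiding [e'] adds to the [m + 1] disjoint paths carried by [e']. *)
apply/negP=> con; suff : (m.+2 <= m.+1)%N by rewrite ltnn.
apply: (flow _ _ _ n'); rewrite -addn1 -c12m.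
have := hX' e'; rewrite /c' eqxx => fam.
pose Y := \bigcup_(a in setT :\ e') X' a.
have dY : [disjoint X' e' & Y].
  apply: bigcup_disjoint => a; rewrite !inE andbT => ae.
  by rewrite dX' // eq_sym.
apply: path_familyS (subsetT _) (path_familyD _ _ _ _ _ _ _ dY fam _).
apply: path_family1; apply: connect_hom con => a ae.
apply: connect_adjS (path_family_connect _ _ _ _ _ (c0' a) (hX' a)).
exact: bigcup_sup.
Qed.

End SeriesParallel.

Lemma mmf_path_family (G : graph) (x y : gV G) k :
  x != y -> path_family G setT x y k -> (k <= mmf G)%N.
Proof.
move=> xy /(lam_ge _ (full x y) _ xy) h.
have := @leq_bigmax_cond (gV G) (fun z => z != x) (fun z => lam (full x z)) y.
rewrite eq_sym => /(_ xy) /(leq_trans h) hx; apply: leq_trans hx _.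
exact: (@leq_bigmax (gV G) (fun u => \max_(z : gV G | z != u) lam (full u z))%N x).
Qed.

Theorem theorem4p1 (F : numClosedFieldType) (q : F) (L : nat)
  (S : nat -> F -> Prop)
  (hq : q != 0) (hL : (2 <= L)%N)
  (hnest : forall k : nat, (1 <= k)%N -> (k < L.-1)%N ->
             forall x, S k x -> S k.+1 x)
  (h1 : forall k l : nat, (1 <= k <= L.-1)%N -> (1 <= l <= L.-1)%N ->
          forall a b, S k a -> S l b ->
            q + a + b != 0 /\ S (minn k l) (serq q a b))
  (h2 : forall k l : nat, (1 <= k)%N -> (1 <= l)%N -> (k + l <= L.-1)%N ->
          forall a b, S k a -> S l b -> S (k + l)%N (parc a b)) :
  (forall (G : graph) (s t : gV G) (tr : dtree G) (v : gE G -> F),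
      tsp (full s t) ->
      decomp_tree tr (full s t) ->
      maximal tr ->
      all_proper (fun T => (lam T <= L.-1)%N) tr ->
      (forall e, S 1%N (v e)) ->
      all_nodes (fun T => (lam T <= L.-1)%N ->
                   Apoly q v T != 0 /\ S (lam T) (Bpoly q v T / Apoly q v T)) tr)
  /\
  (~ S L.-1 (- q) ->
   (forall k l : nat, (1 <= k)%N -> (1 <= l)%N -> (k + l)%N = L ->
      forall a b, S k a -> S l b -> parc a b != - q) ->
   forall (G : graph) (v : gE G -> F),
     loopless G -> sp_graph G -> (mmf G <= L)%N ->
     (forall e, S 1%N (v e)) ->
     Zpoly q v != 0).
Proof.
have m0 : (0 < L.-1)%N by lia.
split=> [G s t tr v tG [lG [vtr labtr]] Mtr small hv|nq hpq G v lG spG hG hv].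
  apply: (good_weight_tree hq hnest h1 h2 G s t v tr) => //.
  rewrite labtr; split=> //=; exact: subsetT.
have eL : L = L.-1.+1 by lia.
rewrite {}eL in hpq hG.
apply: (Zpoly_series_parallel hq hnest h1 h2 nq hpq G G id (fun e => [set e]) (fun=> 1%N)) => //.
- by move=> x y k xy /(mmf_path_family _ _ _ _ xy)/leq_trans; apply.
- split=> // [e e' ee|e].
    by rewrite disjoints1 inE.
  by apply: path_family1; apply: joins_connect (joinsE _ _); rewrite inE.
by move=> e; left.
Qed.
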